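(* Let $l\ge 0$ and $n\ge 1$ be integers. Let $\mathfrak{g}\subset\mathcal{K}(2l+1|n)$ be the Lie superalgebra of contact vector fields $X_f$ on $\mathbb{R}^{2l+1|n}$ whose associated superfunction $f$ is polynomial of degree at most two in the variables $z,x_1,\dots,x_l,y_1,\dots,y_l,\theta_1,\dots,\theta_n$. Then $\mathfrak{g}$ is isomorphic, as a Lie superalgebra, to $\mathfrak{spo}(2l+2|n)$.
   Context: Superspace: $C^\infty(\mathbb{R}^{2l+1|n})=C^\infty(\mathbb{R}^{2l+1})\otimes\Lambda\mathbb{R}^n$ is the real supercommutative superalgebra of superfunctions, with even coordinates $z,x_1,\dots,x_l,y_1,\dots,y_l$ and odd coordinates $\theta_1,\dots,\theta_n$ ($\theta_i\theta_j=-\theta_j\theta_i$). A tilde denotes parity. Vector fields are superderivations of $C^\infty(\mathbb{R}^{2l+1|n})$, with bracket $[X,Y]=XY-(-1)^{\tilde X\tilde Y}YX$ on homogeneous elements. Vector fields $T_r$, $1\le r\le 2l+n$: $T_r=\partial_{x_r}+y_r\partial_z$ for $1\le r\le l$; $T_r=\partial_{y_{r-l}}-x_{r-l}\partial_z$ for $l+1\le r\le 2l$; $T_r=\partial_{\theta_{r-2l}}-\theta_{r-2l}\partial_z$ for $2l+1\le r\le 2l+n$; so $\tilde T_r=0$ for $r\le 2l$ and $\tilde T_r=1$ for $r>2l$. They span over $C^\infty(\mathbb{R}^{2l+1|n})$ the kernel $\mathrm{Tan}(\mathbb{R}^{2l+1|n})$ of the contact form $\alpha=dz+\sum_{i=1}^l(x_idy_i-y_idx_i)+\sum_{j=1}^n\theta_jd\theta_j$.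 A contact vector field is a vector field $X$ with $[X,T]\in\mathrm{Tan}(\mathbb{R}^{2l+1|n})$ for all $T\in\mathrm{Tan}(\mathbb{R}^{2l+1|n})$; $\mathcal{K}(2l+1|n)$ is the Lie superalgebra of contact vector fields. These are exactly the fields $$X_f=f\,\partial_z-\tfrac12\sum_{r,s=1}^{2l+n}(-1)^{\tilde f\tilde T_r}\omega^{rs}T_r(f)T_s,\qquad f\in C^\infty(\mathbb{R}^{2l+1|n})$$ (formula for homogeneous $f$, extended linearly), where in blocks of sizes $l,l,n$, $(\omega^{rs})=\begin{pmatrix}0&-\mathrm{id}_l&0\\ \mathrm{id}_l&0&0\\0&0&\mathrm{id}_n\end{pmatrix}$. They satisfy $[X_f,X_g]=X_{\{f,g\}}$ with $\{f,g\}=f\,\partial_z g-(\partial_z f)g-\frac12\sum_{r,s}(-1)^{\tilde T_r\tilde f}\omega^{rs}T_r(f)T_s(g)$, and superfunctions of total degree at most two are closed under $\{\cdot,\cdot\}$, so $\mathfrak{g}$ is a Lie superalgebra. The Lie superalgebra $\mathfrak{spo}(2l+2|n)$: let $\mathbb{R}^{2l+2|n}$ be the super vector space with even part $\mathbb{R}^{2l+2}$ and odd part $\mathbb{R}^n$, $J=\begin{pmatrix}0&-\mathrm{id}_{l+1}\\ \mathrm{id}_{l+1}&0\end{pmatrix}$, $G=\begin{pmatrix}J&0\\0&\mathrm{id}_n\end{pmatrix}$ and $\omega(U,V)=V^tGU$ for $U,V\in\mathbb{R}^{2l+2|n}$. Then $\mathfrak{spo}(2l+2|n)$ is the set of $A\in\mathfrak{gl}(2l+2|n)$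 (real matrices, with the supercommutator) such that $\omega(AU,V)+(-1)^{\tilde A\tilde U}\omega(U,AV)=0$ for all $U,V$ (for homogeneous $A,U$, extended by linearity). *)

(* Defs.v *)
From HB Require Import structures.
From mathcomp Require Import all_boot all_order all_algebra.
From mathcomp Require Import all_classical all_reals all_analysis.
Import Order.TTheory GRing.Theory Num.Theory.
Import numFieldNormedType.Exports.

Set Implicit Arguments.
Unset Strict Implicit.
Unset Printing Implicit Defensive.

Local Open Scope ring_scope.

Section Smooth.
Variables (R : realType) (m : nat).
Implicit Types f g : 'rV[R]_m -> R.

Definition partial (i : 'I_m) f : 'rV[R]_m -> R :=
  fun x => 'D_(delta_mx 0 i) f x.

Fixpoint Ck (k : nat) f : Prop :=
  continuous f /\
  if k is k'.+1 then
    forall i, (forall x, derivable f x (delta_mx 0 i)) /\ Ck k' (partial i f)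
  else True.

Definition smooth f : Prop := forall k, Ck k f.

Lemma Ck_continuous k f : Ck k f -> continuous f.
Proof. by case: k => [|k] []. Qed.

Lemma CkW k f : Ck k.+1 f -> Ck k f.
Proof.
elim: k f => [|k IHk] f [cf df]; first by split.
split=> // i; have [dfi Cdf] := df i; split=> //; exact: IHk.
Qed.

Lemma Ck_cst k (c : R) : Ck k (cst c).
Proof.
elim: k c => [|k IHk] c; split=> //; [exact: cst_continuous..|].
move=> i; split=> [x|]; first exact: derivable_cst.
have -> : partial i (cst c) = cst 0 by apply/funext => x; exact: derive_cst.
exact: IHk.
Qed.

Lemma CkD k f g : Ck k f -> Ck k g -> Ck k (f + g).
Proof.
elim: k f g => [|k IHk] f g [cf df] [cg dg]; split=> //;
  [by move=> x; apply: continuousD; [exact: cf|exact: cg]..|].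
move=> i; have [dfi Cf] := df i; have [dgi Cg] := dg i.
split=> [x|]; first exact: derivableD.
have -> : partial i (f + g) = partial i f + partial i g.
  by apply/funext => x; rewrite /partial deriveD.
exact: IHk.
Qed.

Lemma CkM k f g : Ck k f -> Ck k g -> Ck k (f * g).
Proof.
elim: k f g => [|k IHk] f g Cf Cg;
  have cfg : continuous (f * g) by move=> x; apply: continuousM;
    [exact: (Ck_continuous Cf)|exact: (Ck_continuous Cg)].
- by split.
split=> // i; have [_ /(_ i)[dfi Cdf]] := Cf; have [_ /(_ i)[dgi Cdg]] := Cg.
split=> [x|]; first exact: derivableM.
have -> : partial i (f * g) = f * partial i g + g * partial i f.
  by apply/funext => x; rewrite /partial deriveM.
by apply: CkD; apply: IHk => //; exact: CkW.
Qed.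

Lemma Ck_coord k (i : 'I_m) : Ck k (fun x : 'rV[R]_m => x 0 i).
Proof.
case: k => [|k]; split=> //; [exact: coord_continuous..|].
move=> j.
pose coord_i := fun y : 'rV[R]_m => y 0 i.
have lin : linear (coord_i : _ -> R^o) by move=> a u v; rewrite /coord_i !mxE.
pose linM := GRing.isLinear.Build _ _ _ _ _ lin.
pose lcoord : {linear 'rV[R]_m -> R^o} := HB.pack coord_i linM.
have dcoord x : is_derive x (delta_mx 0 j) coord_i
    ((delta_mx 0 j : 'rV[R]_m) 0 i).
  have dc : differentiable coord_i x by exact: differentiable_coord.
  apply: DeriveDef; first exact: diff_derivable.
  rewrite deriveE // (diff_lin (f := lcoord)) //; exact: coord_continuous.
split=> [x|]; first by have [] := dcoord x.
have -> : partial j (fun x => x 0 i) = cst ((delta_mx 0 j : 'rV[R]_m) 0 i).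
  by apply/funext => x; rewrite /partial derive_val.
exact: Ck_cst.
Qed.

Definition smooth_pred : {pred 'rV[R]_m -> R} := mem [set f | smooth f]%classic.

Fact smooth_subring : subring_closed smooth_pred.
Proof.
have opp f : smooth f -> smooth (- f).
  by move=> Cf k; rewrite -mulN1r; apply: CkM => //; exact: (Ck_cst k (-1)).
split=> [|f g|f g]; rewrite !inE.
- by move=> k; exact: Ck_cst.
- by move=> Cf /opp Cg k; exact: CkD.
- by move=> Cf Cg k; exact: CkM.
Qed.

Fact smooth_submod : subsemimod_closed smooth_pred.
Proof.
split; first split; rewrite ?inE.
- by move=> k; exact: Ck_cst.
- by move=> f g; rewrite !inE => Cf Cg k; exact: CkD.
move=> a f; rewrite !inE => Cf k.
by apply: (@CkM k (cst a)) => //; exact: Ck_cst.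
Qed.

Record smoothfun := SmoothFun {
  smoothfun_val :> 'rV[R]_m -> R;
  _ : smoothfun_val \in smooth_pred }.

HB.instance Definition _ := [isSub for smoothfun_val].
HB.instance Definition _ := [Choice of smoothfun by <:].
HB.instance Definition _ :=
  GRing.SubChoice_isSubComNzRing.Build _ smooth_pred smoothfun smooth_subring.
HB.instance Definition _ :=
  GRing.SubZmodule_isSubLmodule.Build _ _ smooth_pred smoothfun smooth_submod.

Fact smoothfun_scalerAl (a : R) (f g : smoothfun) : a *: (f * g) = a *: f * g.
Proof. by apply/val_inj/funext => x; exact: mulrA. Qed.

HB.instance Definition _ :=
  GRing.Lmodule_isLalgebra.Build R smoothfun smoothfun_scalerAl.
HB.instance Definition _ := GRing.Lalgebra_isComAlgebra.Build R smoothfun.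

Lemma smoothfunP (f : smoothfun) : smooth f.
Proof. by case: f => f Pf; have := set_mem Pf. Qed.

Fact smooth_coord_subproof (i : 'I_m) :
  (fun x : 'rV[R]_m => x 0 i) \in smooth_pred.
Proof. by rewrite inE => k; exact: Ck_coord. Qed.

Definition smooth_coord (i : 'I_m) : smoothfun :=
  SmoothFun (smooth_coord_subproof i).

Fact smooth_partial_subproof (i : 'I_m) (f : smoothfun) :
  partial i f \in smooth_pred.
Proof. by rewrite inE => k; have [_ /(_ i)[]] := smoothfunP f k.+1. Qed.

Definition smooth_partial (i : 'I_m) (f : smoothfun) : smoothfun :=
  SmoothFun (smooth_partial_subproof i f).

End Smooth.

(* theta_I * theta_J = theta_sign I J *: theta_(I :|: J), where theta_I is the
   product of the theta_i, i in I, in increasing order. *)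
Definition theta_sign (R : pzRingType) n (I J : {set 'I_n}) : R :=
  if [disjoint I & J] then (-1) ^+ (\sum_(i in I) \sum_(j in J) (j < i)%N)
  else 0.

Section ThetaSign.
Variables (R : pzRingType) (n : nat).
Implicit Types I J K : {set 'I_n}.

Lemma theta_sign0l I : theta_sign R finset.set0 I = 1.
Proof.
by rewrite /theta_sign finset.disjoints_subset finset.sub0set big_set0.
Qed.

Lemma theta_sign0r I : theta_sign R I finset.set0 = 1.
Proof.
rewrite /theta_sign disjoint_sym finset.disjoints_subset finset.sub0set big1 // => i _.
by rewrite big_set0.
Qed.

Lemma disjointsUl I J K :
  [disjoint (I :|: J)%SET & K] = [disjoint I & K] && [disjoint J & K].
Proof. by rewrite !finset.disjoints_subset finset.subUset. Qed.

Lemma big_disjU I J (F : 'I_n -> nat) : [disjoint I & J] ->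
  (\sum_(i in (I :|: J)%SET) F i = \sum_(i in I) F i + \sum_(i in J) F i)%N.
Proof.
move=> dIJ; rewrite -bigU //; apply: eq_bigl => i.
by rewrite finset.in_setU.
Qed.

Lemma theta_signA I J K :
  theta_sign R I J * theta_sign R (I :|: J)%SET K =
  theta_sign R I (J :|: K)%SET * theta_sign R J K.
Proof.
rewrite /theta_sign disjointsUl [X in _ = (if X then _ else _) * _]disjoint_sym.
rewrite disjointsUl ![[disjoint _ & I]]disjoint_sym.
have [dIJ|] := boolP [disjoint I & J]; last by rewrite !mul0r.
have [dIK|] := boolP [disjoint I & K]; last by rewrite !mulr0 mul0r.
have [dJK|] := boolP [disjoint J & K]; last by rewrite !mulr0.
rewrite -!exprD (big_disjU _ dIJ); congr (_ ^+ _).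
rewrite addnA -big_split; congr (_ + _)%N; apply: eq_bigr => i _.
by rewrite (big_disjU _ dJK).
Qed.

End ThetaSign.

(* C^oo(R^m) tensor Lambda R^n: the superfunction \sum_I f_I theta_I is
   represented by the family of its coefficients f_I. *)
Definition superfun (R : realType) (m n : nat) : Type :=
  {ffun {set 'I_n} -> smoothfun R m}.

Section Superfun.
Variables (R : realType) (m n : nat).
Local Notation SF := (superfun R m n).
Implicit Types f g h : SF.

HB.instance Definition _ :=
  GRing.Lmodule.copy SF {ffun {set 'I_n} -> smoothfun R m}.

Definition superfun_one : SF :=
  [ffun I : {set 'I_n} => (I == finset.set0)%:R].

Definition superfun_mul f g : SF :=
  [ffun K : {set 'I_n} => \sum_(I : {set 'I_n})
     \sum_(J : {set 'I_n} | (I :|: J)%SET == K)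
       theta_sign R I J *: (f I * g J)].

Let sum_setU (F : {set 'I_n} -> {set 'I_n} -> {set 'I_n} -> smoothfun R m) :
  \sum_L \sum_I \sum_(J | (I :|: J)%SET == L) F I J L =
  \sum_I \sum_J F I J (I :|: J)%SET.
Proof.
rewrite exchange_big; apply: eq_bigr => I _.
rewrite (exchange_big_dep xpredT) //=; apply: eq_bigr => J _.
by under eq_bigl do rewrite eq_sym; rewrite big_pred1_eq.
Qed.

Fact superfun_mulA : associative superfun_mul.
Proof.
move=> f g h; apply/ffunP => K; rewrite !ffunE.
pose X I J M := (theta_sign R I (J :|: M)%SET * theta_sign R J M) *:
  (f I * (g J * h M)).
transitivity (\sum_I \sum_J \sum_(M | (I :|: (J :|: M))%SET == K) X I J M).
  apply: eq_bigr => I _; rewrite big_mkcond.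
  under [RHS]eq_bigr do rewrite big_mkcond.
  rewrite -(sum_setU (fun J M L => if (I :|: L)%SET == K then X I J M else 0)).
  apply: eq_bigr => L _; rewrite ffunE.
  have [_|_] := eqVneq; last by rewrite big1 // => J _; rewrite big1.
  rewrite mulr_sumr scaler_sumr; apply: eq_bigr => J _.
  rewrite mulr_sumr scaler_sumr; apply: eq_bigr => M /eqP <-.
  by rewrite -scalerAr scalerA.
rewrite -(sum_setU (fun I J L => \sum_(M | (I :|: (J :|: M))%SET == K) X I J M)).
apply: eq_bigr => L _; under [RHS]eq_bigr do rewrite ffunE mulr_suml scaler_sumr.
rewrite [RHS]exchange_big; apply: eq_bigr => I _.
under [RHS]eq_bigr do rewrite mulr_suml scaler_sumr.
rewrite [RHS]exchange_big; apply: eq_bigr => J /eqP <-.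
apply: eq_big => [M|M _]; first by rewrite finset.setUA.
by rewrite /X -theta_signA -scalerAl scalerA mulrA mulrC.
Qed.

Fact superfun_mul1 : left_id superfun_one superfun_mul.
Proof.
move=> f; apply/ffunP => K; rewrite ffunE (bigD1 finset.set0) //=.
rewrite [X in _ + X]big1 ?addr0 => [|I I0]; last first.
  by apply: big1 => J _; rewrite ffunE (negbTE I0) mul0r scaler0.
under eq_bigl do rewrite finset.set0U.
by rewrite big_pred1_eq ffunE eqxx mul1r theta_sign0l scale1r.
Qed.

Fact superfun_mulr1 : right_id superfun_one superfun_mul.
Proof.
move=> f; apply/ffunP => K; rewrite ffunE (bigD1 K) //=.
rewrite [X in _ + X]big1 ?addr0 => [|I IK]; last first.
  apply: big1 => J /eqP IJ; rewrite ffunE; case: eqVneq IJ => [->|]; last first.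
    by rewrite mulr0 scaler0.
  by rewrite finset.setU0 => IE; rewrite IE eqxx in IK.
rewrite (bigD1 finset.set0) ?finset.setU0 //= big1 ?addr0 => [|J /andP[_ J0]].
  by rewrite ffunE eqxx mulr1 theta_sign0r scale1r.
by rewrite ffunE (negbTE J0) mulr0 scaler0.
Qed.

Fact superfun_mulDl : left_distributive superfun_mul +%R.
Proof.
move=> f g h; apply/ffunP => K; rewrite !ffunE -big_split /=.
apply: eq_bigr => I _; rewrite -big_split /=; apply: eq_bigr => J _.
by rewrite ffunE mulrDl scalerDr.
Qed.

Fact superfun_mulDr : right_distributive superfun_mul +%R.
Proof.
move=> f g h; apply/ffunP => K; rewrite !ffunE -big_split /=.
apply: eq_bigr => I _; rewrite -big_split /=; apply: eq_bigr => J _.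
by rewrite ffunE mulrDr scalerDr.
Qed.

Fact superfun_one_neq0 : superfun_one != 0.
Proof.
apply/eqP => /ffunP /(_ finset.set0) /eqP.
by rewrite !ffunE eqxx oner_eq0.
Qed.

HB.instance Definition _ := GRing.Zmodule_isNzRing.Build SF
  superfun_mulA superfun_mul1 superfun_mulr1 superfun_mulDl superfun_mulDr
  superfun_one_neq0.

Fact superfun_scalerAl (a : R) f g : a *: (f * g) = a *: f * g.
Proof.
apply/ffunP => K; rewrite !ffunE scaler_sumr; apply: eq_bigr => I _.
rewrite scaler_sumr; apply: eq_bigr => J _.
by rewrite ffunE -scalerAl !scalerA mulrC.
Qed.

Fact superfun_scalerAr (a : R) f g : a *: (f * g) = f * (a *: g).
Proof.
apply/ffunP => K; rewrite !ffunE scaler_sumr; apply: eq_bigr => I _.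
rewrite scaler_sumr; apply: eq_bigr => J _.
by rewrite ffunE -scalerAr !scalerA mulrC.
Qed.

HB.instance Definition _ :=
  GRing.Lmodule_isLalgebra.Build R SF superfun_scalerAl.
HB.instance Definition _ :=
  GRing.Lalgebra_isAlgebra.Build R SF superfun_scalerAr.

End Superfun.

Section SuperCalculus.
Variables (R : realType) (m n : nat).
Local Notation SF := (superfun R m n).
Implicit Types (b c : bool) (f g : SF) (X Y : SF -> SF).

Definition even_coord (i : 'I_m) : SF :=
  [ffun I : {set 'I_n} => if I == finset.set0 then smooth_coord R i else 0].

Definition odd_coord (j : 'I_n) : SF :=
  [ffun I : {set 'I_n} => (I == [set j]%SET)%:R].

Definition supercoord (u : 'I_m + 'I_n) : SF :=
  match u with inl i => even_coord i | inr j => odd_coord j end.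

(* parity: false is even, true is odd *)
Definition superfun_part b f : SF :=
  [ffun I : {set 'I_n} => if odd #|I| == b then f I else 0].

Definition even_partial (i : 'I_m) f : SF :=
  [ffun I : {set 'I_n} => smooth_partial i (f I)].

(* The left derivative: theta_(j |: I) = theta_sign [set j] I *: theta_j theta_I
   if j \notin I; the coefficient theta_sign [set j] I vanishes if j \in I. *)
Definition odd_partial (j : 'I_n) f : SF :=
  [ffun I : {set 'I_n} => theta_sign R [set j]%SET I *: f (j |: I)%SET].

Definition polynomial_deg_le2 f : Prop :=
  exists (c : R) (a : 'I_m + 'I_n -> R) (q : 'I_m + 'I_n -> 'I_m + 'I_n -> R),
    f = c%:A + \sum_u a u *: supercoord u
        + \sum_u \sum_v q u v *: (supercoord u * supercoord v).

(* The component of X that sends superfunctions of parity c to superfunctions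
   of parity b + c. *)
Definition op_part b X : SF -> SF :=
  fun f => \sum_(c : bool) superfun_part (b (+) c) (X (superfun_part c f)).

(* The supercommutator, extended bilinearly from the homogeneous operators. *)
Definition op_bracket X Y : SF -> SF :=
  \sum_(b : bool) \sum_(c : bool)
    ((op_part b X \o op_part c Y) -
     (-1) ^+ (b && c) *: (op_part c Y \o op_part b X)).

Definition vector_field X : Prop :=
  (forall (a : R) f g, X (a *: f + g) = a *: X f + X g) /\
  (forall b c f g, superfun_part c f = f ->
     op_part b X (f * g) =
     op_part b X f * g + (-1) ^+ (b && c) *: (f * op_part b X g)).

End SuperCalculus.

Section Contact.
Variables (R : realType) (l n : nat).
Local Notation SF := (superfun R (1 + (l + l)) n).
Implicit Types (f g : SF) (X T : SF -> SF).

(* The even coordinates are z, x_1, ..., x_l, y_1, ..., y_l, in this order. *)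
Definition z_idx : 'I_(1 + (l + l)) := lshift (l + l) ord0.
Definition x_idx (i : 'I_l) : 'I_(1 + (l + l)) := rshift 1 (lshift l i).
Definition y_idx (i : 'I_l) : 'I_(1 + (l + l)) := rshift 1 (rshift l i).

Local Notation z := (even_coord R n z_idx).
Local Notation x i := (even_coord R n (x_idx i)).
Local Notation y i := (even_coord R n (y_idx i)).
Local Notation theta j := (odd_coord R (1 + (l + l)) j).
Local Notation d_z := (even_partial z_idx).

(* The value on X of alpha = dz + \sum_i (x_i dy_i - y_i dx_i)
   + \sum_j theta_j dtheta_j. The pairing is linear over superfunctions on the
   left of X; as dtheta_j is even, theta_j dtheta_j = dtheta_j theta_j, whose
   value on X is X(theta_j) theta_j. This is the convention for which the
   fields [contact_frame r] below lie in the kernel of alpha, and span it. *)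
Definition contact_form X : SF :=
  X z + \sum_(i < l) (x i * X (y i) - y i * X (x i))
      + \sum_(j < n) X (theta j) * theta j.

Definition tangent X : Prop := vector_field X /\ contact_form X = 0.

Definition contact_vector_field X : Prop :=
  vector_field X /\ forall T, tangent T -> tangent (op_bracket X T).

Definition contact_frame (r : 'I_(l + l + n)) : SF -> SF :=
  match fintype.split r with
  | inl s =>
    match fintype.split s with
    | inl i => fun f => even_partial (x_idx i) f + y i * d_z f
    | inr i => fun f => even_partial (y_idx i) f - x i * d_z f
    end
  | inr j => fun f => odd_partial j f - theta j * d_z f
  end.

Definition contact_frame_odd (r : 'I_(l + l + n)) : bool := (l + l <= r)%N.

Definition contact_omega : 'M[R]_(l + l + n) :=
  block_mx (block_mx 0 (- 1%:M) 1%:M 0) 0 0 1%:M.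

(* The field X_f; the sum over b extends the formula linearly from the
   homogeneous superfunctions. *)
Definition contact_field f : SF -> SF := fun g =>
  \sum_(b : bool)
    (superfun_part b f * d_z g -
     2^-1 *: \sum_r \sum_s
       ((-1) ^+ (b && contact_frame_odd r) * contact_omega r s) *:
         (contact_frame r (superfun_part b f) * contact_frame s g)).

End Contact.

(* An ambient module with parity projections and a bracket. No law is required
   here: the Lie superalgebra axioms are required on the subspaces g : set L
   by [is_lie_superalgebra], where x is homogeneous of parity b when
   part b x = x. *)
Record bracketSpace (R : pzRingType) := BracketSpace {
  bracket_carrier :> lmodType R;
  part : bool -> bracket_carrier -> bracket_carrier;
  bracket : bracket_carrier -> bracket_carrier -> bracket_carrier }.

Record is_lie_superalgebra (R : pzRingType) (L : bracketSpace R) (g : set L) :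
    Prop := IsLieSuperalgebra {
  lsa_zero : g 0;
  lsa_linear : forall a x y, g x -> g y -> g (a *: x + y);
  lsa_part : forall b x, g x -> g (part b x);
  lsa_part_linear : forall b a x y, g x -> g y ->
    part b (a *: x + y) = a *: part b x + part b y;
  lsa_part_part : forall b c x, g x ->
    part b (part c x) = if b == c then part c x else 0;
  lsa_part_sum : forall x, g x -> x = part false x + part true x;
  lsa_bracket : forall x y, g x -> g y -> g (bracket x y);
  lsa_bracket_linearl : forall a x y z, g x -> g y -> g z ->
    bracket (a *: x + y) z = a *: bracket x z + bracket y z;
  lsa_bracket_linearr : forall a x y z, g x -> g y -> g z ->
    bracket x (a *: y + z) = a *: bracket x y + bracket x z;
  lsa_bracket_part : forall b c x y, g x -> g y ->
    part b x = x -> part c y = y -> part (b (+) c) (bracket x y) = bracket x y;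
  lsa_skew : forall b c x y, g x -> g y -> part b x = x -> part c y = y ->
    bracket x y = - ((-1) ^+ (b && c) *: bracket y x);
  lsa_jacobi : forall b c x y z, g x -> g y -> g z ->
    part b x = x -> part c y = y ->
    bracket x (bracket y z) =
    bracket (bracket x y) z + (-1) ^+ (b && c) *: bracket y (bracket x z) }.

(* Only the restriction of phi to g matters. *)
Definition lie_superalgebra_isomorphic (R : pzRingType) (L M : bracketSpace R)
    (g : set L) (h : set M) : Prop :=
  [/\ is_lie_superalgebra g, is_lie_superalgebra h &
    exists phi : L -> M,
      [/\ set_bij g h phi,
          forall a x y, g x -> g y -> phi (a *: x + y) = a *: phi x + phi y,
          forall b x, g x -> phi (part b x) = part b (phi x) &
          forall x y, g x -> g y ->
            phi (bracket x y) = bracket (phi x) (phi y)]].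

Definition operator_space (R : realType) (m n : nat) : bracketSpace R :=
  BracketSpace (bracket_carrier := superfun R m n -> superfun R m n)
    (@op_part R m n) (@op_bracket R m n).

Definition contact_algebra_deg2 (R : realType) (l n : nat) :
    set (operator_space R (1 + (l + l)) n) :=
  fun X => contact_vector_field X /\
    exists2 f, polynomial_deg_le2 f & X = contact_field f.

Section Spo.
Variables (R : realType) (p n : nat).

Definition gl_part (b : bool) (A : 'M[R]_(p + n)) : 'M[R]_(p + n) :=
  if b then block_mx 0 (ursubmx A) (dlsubmx A) 0
  else block_mx (ulsubmx A) 0 0 (drsubmx A).

Definition gl_bracket (A B : 'M[R]_(p + n)) : 'M[R]_(p + n) :=
  \sum_(b : bool) \sum_(c : bool)
    (gl_part b A *m gl_part c B -
     (-1) ^+ (b && c) *: (gl_part c B *m gl_part b A)).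

Definition gl_space : bracketSpace R := BracketSpace gl_part gl_bracket.

Definition vec_part (b : bool) (U : 'cV[R]_(p + n)) : 'cV[R]_(p + n) :=
  if b then col_mx 0 (dsubmx U) else col_mx (usubmx U) 0.

End Spo.

Definition spo_gram (R : realType) (l n : nat) : 'M[R]_(l.+1 + l.+1 + n) :=
  block_mx (block_mx 0 (- 1%:M) 1%:M 0) 0 0 1%:M.

Definition spo_form (R : realType) (l n : nat)
    (U V : 'cV[R]_(l.+1 + l.+1 + n)) : R :=
  (V^T *m spo_gram R l n *m U) 0 0.

(* The sums over the parities b of A and c of U extend the defining condition
   linearly from the homogeneous A and U. *)
Definition spo (R : realType) (l n : nat) :
    set (gl_space R (l.+1 + l.+1) n) :=
  fun A => forall U V : 'cV[R]_(l.+1 + l.+1 + n),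
    \sum_(b : bool) \sum_(c : bool)
      (spo_form (gl_part b A *m vec_part c U) V +
       (-1) ^+ (b && c) * spo_form (vec_part c U) (gl_part b A *m V)) = 0.

(* Main.v *)
(* Put W = (1, x_1, ..., x_l, z, y_1, ..., y_l, theta_1, ..., theta_n), the
   affine chart of R^(2l+2|n), and let G be the Gram matrix of the form omega.
   A superfunction of degree at most two is W Q W^t for a unique supersymmetric
   matrix Q, and A |-> A G is a bijection from spo(2l+2|n) onto these matrices.
   For f = W A G W^t the operator X_f - 1/2 (d_z f), that is, the action of X_f
   on densities of weight -1/2, maps W to W A. As W_1 = 1, this gives
     X_f (W_a) = (W A)_a - (W A)_1 W_a,
   so A acts through the projective action of the linear supergroup, and
   A |-> X_f is compatible with the brackets on the coordinates. Both sides are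
   superderivations of first order, hence determined by their values on the
   coordinates; for a bracket this rests on the symmetry of the second partial
   derivatives. The invariance of the contact distribution under X_f is a
   computation on W as well, since the contact form of a vector field Y is
   \sum_(a, b) G_ab Y(W_a) W_b. *)
Require Import Defs.
From HB Require Import structures.
From mathcomp Require Import all_boot all_order all_algebra.
From mathcomp Require Import all_classical all_reals all_analysis.
From mathcomp Require Import ring lra.
Import Order.TTheory GRing.Theory Num.Theory.
Import numFieldNormedType.Exports.

Set Implicit Arguments.
Unset Strict Implicit.
Unset Printing Implicit Defensive.

Local Open Scope ring_scope.

(** * Symmetry of the second partial derivatives of a C^2 function *)

Section Schwarz.
Variables (R : realType) (m : nat).
Implicit Types (f : 'rV[R]_m -> R) (x u v : 'rV[R]_m).

(** The weight -1/2 comes from the contact form being quadratic in W: a factor on W acts on it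
    through its square, and X_f multiplies the contact form by d_z f, so W takes half of that. On
    the symplectization f has degree two, each W_a degree one, and X_f is a Hamiltonian field; the
    coefficients of f * d_z g and d_z f * g in [density_action] and [chart_form] are half the
    degrees of f and g. The obstacle is that the coordinates do not generate the smooth functions:
    values on coordinates determine a superderivation only once it is known to be a first-order
    operator. Rather than being proved for all superderivations, this is carried along as
    [chain_rule], checked on the contact frame and shown stable under combinations and brackets. In
    the contact condition the tangent field T is an arbitrary superderivation; neither a chain rule
    nor an expansion in the frame is used for it, only its values on the chart and its Leibniz rule.
    The map is built from matrices to fields, where linearity and brackets are explicit, and
    inverted at the very end. *)

Lemma is_derive_line f x v (t : R) : derivable f (x + t *: v) v ->
  is_derive t 1 (fun s => f (x + s *: v)) ('D_v f (x + t *: v)).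
Proof.
have E : (fun h : R => h^-1 *: (f (x + (h *: (1 : R) + t) *: v) - f (x + t *: v))) =
   (fun h : R => h^-1 *: (f (h *: v + (x + t *: v)) - f (x + t *: v))).
  by apply/funext => h; rewrite scalerDl addrCA [h *: 1]mulr1.
move=> df; apply: DeriveDef.
  by move: df; rewrite /derivable /= => df; rewrite E.
by rewrite /derive /= E.
Qed.

Lemma mean_value_line f x v (h : R) : 0 < h -> (forall y, derivable f y v) ->
  exists2 c, 0 < c < h & f (x + h *: v) - f x = 'D_v f (x + c *: v) * h.
Proof.
move=> h0 df.
have D (t : R) : is_derive t 1 (fun s => f (x + s *: v)) ('D_v f (x + t *: v)).
  exact: is_derive_line.
have [|c] := MVT h0 (fun t _ => D t).
  apply: derivable_within_continuous => t _.
  by have [] := D t.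
rewrite in_itv /= => ch; rewrite scale0r addr0 subr0 => E.
by exists c.
Qed.

Lemma shift_quotient f x v w :
  (fun h : R => h^-1 *: (f (h *: v + x + w) - f (x + w))) =
  (fun h : R => h^-1 *: (f (h *: v + (x + w)) - f (x + w))).
Proof. by apply/funext => h; rewrite addrA. Qed.

Lemma derive_shift f x v w : 'D_v (fun y => f (y + w)) x = 'D_v f (x + w).
Proof. by rewrite /derive /= shift_quotient. Qed.

Lemma derivable_shift f x v w : derivable f (x + w) v ->
  derivable (fun y => f (y + w)) x v.
Proof. by rewrite /derivable /= shift_quotient. Qed.

(** The mean value theorem is applied twice: along u to the increment of f in the direction v, then
    along v to the u-derivative at the point found. The left side is symmetric in u and v, which
    [partialC] exploits. *)
Lemma second_difference f x u v (h : R) : 0 < h ->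
  (forall y, derivable f y u) -> (forall y, derivable ('D_u f) y v) ->
  exists c d, [/\ 0 < c < h, 0 < d < h &
   f (x + h *: u + h *: v) - f (x + h *: u) - f (x + h *: v) + f x =
   'D_v ('D_u f) (x + c *: u + d *: v) * h * h].
Proof.
move=> h0 du dv.
pose g y := f (y + h *: v) - f y.
have dg y : derivable g y u by apply: derivableB => //; exact: derivable_shift.
have [c ch Ec] := mean_value_line x h0 dg.
have [d dh Ed] := mean_value_line (x + c *: u) h0 dv.
exists c, d; split=> //.
rewrite -Ed; have <- : 'D_u g (x + c *: u) =
    'D_u f (x + c *: u + h *: v) - 'D_u f (x + c *: u).
  by rewrite /g deriveB ?derive_shift //; exact: derivable_shift.
by rewrite -Ec /g; ring.
Qed.

Lemma norm_near_eq (a b w w' e : R) : w = w' ->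
  `|w - a| < e / 2 -> `|w' - b| < e / 2 -> `|b - a| <= e.
Proof.
move=> -> wa wb; apply: le_trans (ler_distD w' _ _) _.
by rewrite (distrC b) [leRHS]splitr lerD // ltW.
Qed.

(** The second difference over a square of side h, computed in either order, is h^2 times a mixed
    derivative at some point of the square. So the two mixed derivatives share a value at points
    arbitrarily close to x, and by continuity they agree at x. *)
Lemma partialC (i j : 'I_m) f : Ck 2 f ->
  partial i (partial j f) = partial j (partial i f).
Proof.
move=> [_ C]; have [di [ci /(_ j)[dij [cij _]]]] := C i.
have [dj [cj /(_ i)[dji [cji _]]]] := C j.
apply/funext => x; apply/eqP; rewrite -subr_eq0 -normr_le0; apply/ler_addgt0Pl => e e0.
rewrite addr0.
set u : 'rV[R]_m := delta_mx 0 i; set v : 'rV[R]_m := delta_mx 0 j.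
have e20 : 0 < e / 2 by rewrite divr_gt0.
have near_bound (g : 'rV[R]_m -> R) : continuous g -> exists2 h : R, 0 < h &
    forall c d, 0 < c < h -> 0 < d < h -> `|g (x + (c *: u + d *: v)) - g x| < e / 2.
  move=> /(_ x) /cvgr_dist_lt /(_ _ e20) /nbhs_ballP[r /= r0 rP].
  (* Two displacements shorter than r / 2 along vectors of norm at most 1 stay inside the ball of
     radius r. *)
  exists (r / 2); first by rewrite divr_gt0.
  move=> c d /andP[c0 cr] /andP[d0 dr]; rewrite distrC; apply: rP.
  rewrite -ball_normE /= opprD addNKr normrN.
  apply: le_lt_trans (ler_normD _ _) _.
  have nd k : `|delta_mx 0 k : 'rV[R]_m| <= 1.
    change (mx_norm (delta_mx 0 k : 'rV[R]_m) <= 1).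
    case: (eqVneq (mx_norm (delta_mx 0 k : 'rV[R]_m)) 0) => [->//|].
    move=> /mx_norm_neq0[a ->].
    by rewrite mxE; case: (_ && _); rewrite ?normr1 ?normr0.
  rewrite !normrZ (gtr0_norm c0) (gtr0_norm d0).
  have := nd i; have := nd j; rewrite -/u -/v.
  have := normr_ge0 u; have := normr_ge0 v; nra.
have [h1 h10 H1] := near_bound _ cij.
have [h2 h20 H2] := near_bound _ cji.
pose h := Num.min h1 h2.
have h0 : 0 < h by rewrite lt_min h10.
have [c [d [ch dh E1]]] := second_difference x h0 di dij.
have [c' [d' [ch' dh' E2]]] := second_difference x h0 dj dji.
have lt_h t : 0 < t < h -> (0 < t < h1) /\ (0 < t < h2).
  by rewrite lt_min => /andP[-> /andP[-> ->]].
(* Both sides times h * h are the same second difference, with the directions exchanged. *)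
have EE : partial j (partial i f) (x + (c *: u + d *: v)) =
          partial i (partial j f) (x + (d' *: u + c' *: v)).
  apply: (mulIf (lt0r_neq0 h0)); apply: (mulIf (lt0r_neq0 h0)).
  rewrite addrA [d' *: u + _]addrC addrA.
  apply: etrans (esym E1) _; apply: etrans _ E2.
  rewrite [x + _ + h *: v]addrAC; congr (_ + _). exact: addrAC.
exact: norm_near_eq EE (H1 _ _ (lt_h _ ch).1 (lt_h _ dh).1)
  (H2 _ _ (lt_h _ dh').2 (lt_h _ ch').2).
Qed.

End Schwarz.

(** * Partial derivatives on the algebra of smooth functions *)

Section SmoothPartial.
Variables (R : realType) (m : nat).
Implicit Types (f g : smoothfun R m) (i j : 'I_m).

Lemma smooth_derivable i f x : derivable f x (delta_mx 0 i).
Proof. by have [_ /(_ i)[]] := smoothfunP f 1. Qed.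

Fact smooth_partial_is_linear i : linear (@smooth_partial R m i).
Proof.
move=> a f g; apply/val_inj/funext => x.
have df (h : smoothfun R m) := @smooth_derivable i h x.
transitivity ('D_(delta_mx 0 i) (a *: (f : 'rV[R]_m -> R) + g) x) => //.
by rewrite deriveD ?deriveZ //; exact: derivableZ.
Qed.

HB.instance Definition _ i := GRing.isLinear.Build R (smoothfun R m)
  (smoothfun R m) *:%R (@smooth_partial R m i) (smooth_partial_is_linear i).

Lemma smooth_partialM i f g :
  smooth_partial i (f * g) = smooth_partial i f * g + f * smooth_partial i g.
Proof.
apply/val_inj/funext => x.
have df (h : smoothfun R m) := @smooth_derivable i h x.
transitivity ('D_(delta_mx 0 i) ((f : 'rV[R]_m -> R) * g) x) => //.
rewrite deriveM // addrC; congr (_ + _); exact: mulrC.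
Qed.

Lemma smooth_partial1 i : smooth_partial i (1 : smoothfun R m) = 0.
Proof.
have := smooth_partialM i 1 1; rewrite !mulr1 mul1r.
by move/(congr1 (fun h => h - smooth_partial i 1)); rewrite addrK subrr.
Qed.

Lemma smooth_partialC i j f :
  smooth_partial i (smooth_partial j f) = smooth_partial j (smooth_partial i f).
Proof. by apply/val_inj/partialC; exact: smoothfunP. Qed.

Lemma smooth_partial_coord i j :
  smooth_partial i (smooth_coord R j) = (i == j)%:R.
Proof.
apply/val_inj/funext => x; rewrite /= /partial.
pose coord_j := fun y : 'rV[R]_m => y 0 j.
have lin : linear (coord_j : _ -> R^o) by move=> a u v; rewrite /coord_j !mxE.
pose linM := GRing.isLinear.Build _ _ _ _ _ lin.
pose lcoord : {linear 'rV[R]_m -> R^o} := HB.pack coord_j linM.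
rewrite deriveE; last exact: differentiable_coord.
rewrite (diff_lin (f := lcoord)); last exact: coord_continuous.
by rewrite /= /coord_j mxE eqxx eq_sym; case: eqP.
Qed.

End SmoothPartial.

(* The bracket of L is the supercommutator of the product mul, which makes the
   subspace D an associative superalgebra. *)
Record is_supercommutator (R : comPzRingType) (L : bracketSpace R) (D : set L)
    (mul : L -> L -> L) : Prop := IsSupercommutator {
  sc_zero : D 0;
  sc_linear : forall a x y, D x -> D y -> D (a *: x + y);
  sc_part : forall b x, D x -> D (part b x);
  sc_mul : forall x y, D x -> D y -> D (mul x y);
  sc_partP : forall b a (x y : L),
    part b (a *: x + y) = a *: part b x + part b y;
  sc_part_part : forall b c x, D x ->
    part b (part c x) = if b == c then part c x else 0;
  sc_part_sum : forall x, D x -> x = part false x + part true x;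
  sc_mulPl : forall a x y z, mul (a *: x + y) z = a *: mul x z + mul y z;
  sc_mulPr : forall a x y z, D x ->
    mul x (a *: y + z) = a *: mul x y + mul x z;
  sc_mulA : forall x y z, mul x (mul y z) = mul (mul x y) z;
  sc_mul_part : forall b c x y, D x -> D y ->
    part b x = x -> part c y = y -> part (b (+) c) (mul x y) = mul x y;
  sc_bracketE : forall x y : L, bracket x y = \sum_(b : bool)
    \sum_(c : bool) (mul (part b x) (part c y) -
                     (-1) ^+ (b && c) *: mul (part c y) (part b x)) }.

(** * The Lie superalgebra of an associative superalgebra *)

Section SuperCommutator.
Variables (R : comPzRingType) (L : bracketSpace R) (D : set L).
Variable mul : L -> L -> L.
Hypothesis sc : is_supercommutator D mul.

Let D_0 := sc_zero sc.
Let D_linear := sc_linear sc.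
Let D_part := sc_part sc.
Let D_mul := sc_mul sc.
Let partP := sc_partP sc.
Let part_part := sc_part_part sc.
Let part_sum := sc_part_sum sc.
Let mulPl := sc_mulPl sc.
Let mulPr := sc_mulPr sc.
Let mulA := sc_mulA sc.
Let mul_part := sc_mul_part sc.
Let bracketE := sc_bracketE sc.

Implicit Types (b c d : bool) (x y z : L).

Let mul0l z : mul 0 z = 0.
Proof. by have := mulPl (-1) 0 0 z; rewrite scaler0 addr0 scaleN1r addNr. Qed.
Let mul0r x : D x -> mul x 0 = 0.
Proof.
by move=> Dx; have := mulPr (-1) 0 0 Dx; rewrite scaler0 addr0 scaleN1r addNr.
Qed.
Let mulBl x y z : mul (x - y) z = mul x z - mul y z.
Proof. by rewrite addrC -scaleN1r mulPl scaleN1r addrC. Qed.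
Let mulBr x y z : D x -> mul x (y - z) = mul x y - mul x z.
Proof. by move=> Dx; rewrite addrC -scaleN1r mulPr // scaleN1r addrC. Qed.
Let mulZl a x z : mul (a *: x) z = a *: mul x z.
Proof. by rewrite -[a *: x]addr0 mulPl mul0l addr0. Qed.
Let mulZr a x z : D x -> mul x (a *: z) = a *: mul x z.
Proof. by move=> Dx; rewrite -[a *: z]addr0 mulPr // mul0r // addr0. Qed.

Let part_hom b c x : D x -> part c x = x -> part b x = if b == c then x else 0.
Proof. by move=> Dx xE; rewrite -{1}xE part_part // xE. Qed.

Lemma bracket_homogeneous b c x y : D x -> D y -> part b x = x -> part c y = y ->
  bracket x y = mul x y - (-1) ^+ (b && c) *: mul y x.
Proof.
move=> Dx Dy xE yE; rewrite bracketE (bigD1 b) //= (bigD1 c) //= xE yE.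
rewrite !big1 ?addr0 // => [b' bN|c' cN].
  apply: big1 => c' _; rewrite (part_hom _ Dx xE) (negbTE bN).
  by rewrite mul0l mul0r ?scaler0 ?subr0 //; apply: D_part.
by rewrite (part_hom _ Dy yE) (negbTE cN) mul0l mul0r // scaler0 subr0.
Qed.

Let part_hom_part b x : D x -> part b (part b x) = part b x.
Proof. by move=> Dx; rewrite part_part // eqxx. Qed.

Lemma super_bracket_linearl a x y z : D x -> D y -> D z ->
  bracket (a *: x + y) z = a *: bracket x z + bracket y z.
Proof.
move=> Dx Dy Dz; rewrite !bracketE scaler_sumr -big_split /=; apply: eq_bigr => b _.
rewrite scaler_sumr -big_split /=; apply: eq_bigr => c _.
rewrite partP mulPl mulPr; last exact: D_part.
rewrite scalerDr scalerBr !scalerA [(-1) ^+ _ * a]mulrC.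
by rewrite opprD addrACA.
Qed.

Lemma super_bracket_linearr a x y z : D x -> D y -> D z ->
  bracket x (a *: y + z) = a *: bracket x y + bracket x z.
Proof.
move=> Dx Dy Dz; rewrite !bracketE scaler_sumr -big_split /=; apply: eq_bigr => b _.
rewrite scaler_sumr -big_split /=; apply: eq_bigr => c _.
rewrite partP mulPl mulPr; last exact: D_part.
rewrite scalerDr scalerBr !scalerA [(-1) ^+ _ * a]mulrC.
by rewrite opprD addrACA.
Qed.

Lemma super_bracket_closed x y : D x -> D y -> D (bracket x y).
Proof.
have DD u v : D u -> D v -> D (u + v).
  by move=> Du Dv; rewrite -[u]scale1r; apply: D_linear.
have DZ a u : D u -> D (a *: u).
  by move=> Du; rewrite -[_ *: _]addr0; apply: D_linear.
move=> Dx Dy; rewrite bracketE !big_bool /= -!scaleNr.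
repeat first [apply: (DD) | apply: (DZ) | apply: (D_mul) | by apply: D_part].
Qed.

(** With p, q, r the signs of the three pairs, both sides expand into products of x, y, z in various
    orders. On the right the products yxz and zxy occur twice with opposite coefficients, since p *
    p = 1; the other four terms match the left side. *)
Let jacobi_hom b c d x y z : D x -> D y -> D z ->
  part b x = x -> part c y = y -> part d z = z ->
  bracket x (bracket y z) =
  bracket (bracket x y) z + (-1) ^+ (b && c) *: bracket y (bracket x z).
Proof.
move=> Dx Dy Dz xE yE zE.
have DB u v : D u -> D v -> D (bracket u v) by apply: super_bracket_closed.
have part_br b' c' u v : D u -> D v -> part b' u = u -> part c' v = v ->
    part (b' (+) c') (bracket u v) = bracket u v.
  move=> Du Dv uE vE; rewrite (bracket_homogeneous Du Dv uE vE).
  rewrite addrC -scaleNr partP [part _ (mul u v)](mul_part _ _ uE vE) //.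
  by rewrite addbC (mul_part _ _ vE uE).
rewrite (bracket_homogeneous Dx (DB _ _ Dy Dz) xE (part_br _ _ _ _ Dy Dz yE zE)).
rewrite (bracket_homogeneous (DB _ _ Dx Dy) Dz (part_br _ _ _ _ Dx Dy xE yE) zE).
rewrite (bracket_homogeneous Dy (DB _ _ Dx Dz) yE (part_br _ _ _ _ Dx Dz xE zE)).
rewrite (bracket_homogeneous Dx Dy xE yE) (bracket_homogeneous Dy Dz yE zE).
rewrite (bracket_homogeneous Dx Dz xE zE).
rewrite !mulBl !mulBr // !mulZl !mulZr // !mulA.
set A := mul (mul x y) z; set B := mul (mul x z) y; set C := mul (mul y z) x.
set E := mul (mul z y) x; set F := mul (mul y x) z; set G := mul (mul z x) y; clearbody A B C E F G.
have -> : (-1 : R) ^+ (b && (c (+) d)) = (-1) ^+ (b && c) * (-1) ^+ (b && d).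
  by case: b c d {xE yE zE} => [] [] []; rewrite /= ?mulrNN ?mulr1 ?mul1r.
have -> : (-1 : R) ^+ (c && (b (+) d)) = (-1) ^+ (b && c) * (-1) ^+ (c && d).
  by case: b c d {xE yE zE} => [] [] []; rewrite /= ?mulrNN ?mulr1 ?mul1r.
have -> : (-1 : R) ^+ ((b (+) c) && d) = (-1) ^+ (b && d) * (-1) ^+ (c && d).
  by case: b c d {xE yE zE} => [] [] []; rewrite /= ?mulrNN ?mulr1 ?mul1r.
have : (-1 : R) ^+ (b && c) * (-1) ^+ (b && c) = 1 by rewrite -expr2 sqrr_sign.
move: ((-1) ^+ (b && c)) ((-1) ^+ (b && d)) ((-1) ^+ (c && d)) => p q r pp.
rewrite !scalerBr !scalerA !mulrA pp !mul1r [q * r * p]mulrC mulrA [r * q]mulrC.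
move: (r *: B) (p * q *: C) (_ *: E) (p *: F) (q * r *: G) => B1 C1 E1 F1 G1.
rewrite !opprB [RHS]addrACA !addrA !subrK.
by rewrite addrAC [RHS]addrAC [A - C1 - B1]addrAC.
Qed.

(** Serves both algebras, operators under composition and matrices: inside an associative
    superalgebra, a graded subspace only has to be closed under the bracket. *)
Theorem super_bracket_lie (g : set L) : (g `<=` D)%classic ->
  g 0 -> (forall a x y, g x -> g y -> g (a *: x + y)) ->
  (forall b x, g x -> g (part b x)) ->
  (forall x y, g x -> g y -> g (bracket x y)) -> is_lie_superalgebra g.
Proof.
move=> gD g0 gP gpart gbr; split=> //.
- by move=> b c x /gD; exact: part_part.
- by move=> x /gD; exact: part_sum.
- by move=> a x y z /gD Dx /gD Dy /gD; exact: super_bracket_linearl.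
- by move=> a x y z /gD Dx /gD Dy /gD; exact: super_bracket_linearr.
- move=> b c x y /gD Dx /gD Dy xE yE; rewrite (bracket_homogeneous Dx Dy xE yE).
  rewrite addrC -scaleNr partP [part _ (mul x y)](mul_part _ _ xE yE) //.
  by rewrite addbC (mul_part _ _ yE xE).
- move=> b c x y /gD Dx /gD Dy xE yE; rewrite (bracket_homogeneous Dx Dy xE yE).
  rewrite (bracket_homogeneous Dy Dx yE xE) scalerBr scalerA andbC -expr2 sqrr_sign.
  by rewrite scale1r opprB.
(* The third argument of the Jacobi identity is arbitrary, so it is split into its two parts. *)
move=> b c x y z /gD Dx /gD Dy /gD Dz xE yE; rewrite (part_sum Dz).
have Dz' d : D (part d z) by exact: D_part.
have DB u v : D u -> D v -> D (bracket u v) by apply: super_bracket_closed.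
rewrite -{1 2 3}[part false z]scale1r !super_bracket_linearr; try by auto.
rewrite !scale1r.
rewrite (@jacobi_hom b c false x y (part false z)) ?part_hom_part //.
rewrite (@jacobi_hom b c true x y (part true z)) ?part_hom_part //.
by rewrite scalerDr addrACA.
Qed.

End SuperCommutator.

(** * Signs in products of odd coordinates *)

Section ThetaSignTheory.
Variables (R : comPzRingType) (n : nat).
Implicit Types I J K : {set 'I_n}.

Lemma theta_sign_sqr I J : [disjoint I & J] ->
  theta_sign R I J * theta_sign R I J = 1.
Proof. by move=> dIJ; rewrite /theta_sign dIJ -expr2 sqrr_sign. Qed.

Lemma card_disjU I J : [disjoint I & J] -> #|(I :|: J)%SET| = (#|I| + #|J|)%N.
Proof. by move=> dIJ; apply/eqP; rewrite (leq_card_setU I J). Qed.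

(* Each pair (i, j) in I * J is an inversion of exactly one of the two words. *)
Lemma theta_signC I J :
  theta_sign R I J = (-1) ^+ (odd #|I| && odd #|J|) * theta_sign R J I.
Proof.
rewrite /theta_sign disjoint_sym; have [dJI|] := boolP [disjoint J & I]; last first.
  by rewrite mulr0.
have E : (\sum_(i in I) \sum_(j in J) (j < i) +
          \sum_(i in J) \sum_(j in I) (j < i) = #|I| * #|J|)%N.
  rewrite [X in (_ + X)%N]exchange_big -big_split /=.
  rewrite -sum_nat_const; apply: eq_bigr => i iI.
  rewrite -big_split /= -sum1_card; apply: eq_bigr => j jJ.
  have : i != j by apply: contraTneq jJ => <-; rewrite (disjointFl dJI).
  by case: ltngtP => // /val_inj ->; rewrite eqxx.
rewrite -oddM -E signr_odd exprD -mulrA -expr2.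
by rewrite -exprM mulnC exprM sqrrN expr1n expr1n mulr1.
Qed.

Section Insertion.
Variables (j : 'I_n) (I J : {set 'I_n}).
Hypotheses (jI : j \notin I) (jJ : j \notin J).
Local Notation sg := (theta_sign R).

Let disj1 K : j \notin K -> sg [set j]%SET K * sg [set j]%SET K = 1.
Proof.
move=> jK; apply: theta_sign_sqr.
by rewrite finset.disjoints_subset finset.sub1set finset.inE.
Qed.

Let jIJ : j \notin (I :|: J)%SET.
Proof. by rewrite finset.inE negb_or jI. Qed.

Lemma theta_sign_set1r : sg I [set j]%SET = (-1) ^+ #|I| * sg [set j]%SET I.
Proof. by rewrite theta_signC finset.cards1 andbT signr_odd. Qed.

(** [theta_sign_insl], [theta_sign_insr] and [theta_sign_ins2] are the signs in the Leibniz rule for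
    the derivative in theta_j when theta_j occurs in the left factor only, in the right factor only,
    or in both. All come from the cocycle identity [theta_signA] with a singleton among the sets:
    signs of disjoint sets square to 1, so they move freely across an equation. *)
Lemma theta_sign_insl :
  sg [set j]%SET (I :|: J)%SET * sg (j |: I)%SET J = sg [set j]%SET I * sg I J.
Proof.
have := theta_signA R [set j]%SET I J.
move: (disj1 jI) (disj1 jIJ); set a := sg _ (I :|: J)%SET; set x := sg _ I.
set y := sg (j |: I)%SET J => xx aa xy; transitivity (a * (x * x) * y); first by rewrite xx mulr1.
transitivity (a * x * (x * y)); first by ring.
by rewrite xy; transitivity (a * a * x * sg I J); [ring | rewrite aa; ring].
Qed.

Let theta_sign_ins : (-1) ^+ #|I| * (sg [set j]%SET I * sg (j |: I)%SET J) =
  sg I (j |: J)%SET * sg [set j]%SET J.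
Proof.
rewrite mulrA -theta_sign_set1r -theta_signA.
by rewrite [(j |: I)%SET]finset.setUC.
Qed.

Lemma theta_sign_insr : sg [set j]%SET (I :|: J)%SET * sg I (j |: J)%SET =
  (-1) ^+ #|I| * (sg [set j]%SET J * sg I J).
Proof.
have := theta_sign_ins; rewrite theta_signA.
move: (disj1 jJ) (disj1 jIJ); set a := sg _ (I :|: J)%SET; set b := sg I (j |: J)%SET.
set c := sg [set j]%SET J => cc aa E; transitivity (a * b * (c * c)); first by rewrite cc mulr1.
transitivity (a * c * (b * c)); first by ring.
rewrite -E; move: ((-1) ^+ _) => e.
by transitivity (a * a * e * c * sg I J); [ring | rewrite aa; ring].
Qed.

Lemma theta_sign_ins2 : sg [set j]%SET I * sg I (j |: J)%SET =
  (-1) ^+ #|I| * (sg [set j]%SET J * sg (j |: I)%SET J).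
Proof.
have := theta_sign_ins.
move: (disj1 jJ) (disj1 jI); set x := sg _ I; set b := sg I (j |: J)%SET.
set c := sg [set j]%SET J => cc xx E; transitivity (x * b * (c * c)); first by rewrite cc mulr1.
transitivity (x * c * (b * c)); first by ring.
rewrite -E; move: ((-1) ^+ _) => e.
by transitivity (x * x * e * c * sg (j |: I)%SET J); [ring | rewrite xx; ring].
Qed.

End Insertion.

End ThetaSignTheory.

(** * Supercommutativity and Leibniz rules for superfunctions *)

Section SuperfunAlgebra.
Variables (R : realType) (m n : nat).
Local Notation SF := (superfun R m n).
Local Notation part := (@superfun_part R m n).
Implicit Types (b c : bool) (f g h : SF) (phi psi : smoothfun R m).
Implicit Types (I J K : {set 'I_n}) (i : 'I_m) (j : 'I_n).

(** The term phi theta_I. Products and partial derivatives of such terms are again such terms or 0,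
    so additive identities reduce to identities between signs. *)
Definition smono I phi : SF := [ffun K : {set 'I_n} => if K == I then phi else 0].

Fact smono_is_linear I : linear (smono I).
Proof.
move=> a phi psi; apply/ffunP => K; rewrite !ffunE.
by case: eqP; rewrite ?scaler0 ?addr0.
Qed.

HB.instance Definition _ I := GRing.isLinear.Build R (smoothfun R m)
  SF *:%R (smono I) (smono_is_linear I).

Lemma superfun_sum_smono f : f = \sum_I smono I (f I).
Proof.
apply/ffunP => K; rewrite sum_ffunE (bigD1 K) //= ffunE eqxx big1 ?addr0 //.
by move=> I IK; rewrite ffunE eq_sym (negbTE IK).
Qed.

Lemma smonoM I J phi psi :
  smono I phi * smono J psi = smono (I :|: J)%SET (theta_sign R I J *: (phi * psi)).
Proof.
apply/ffunP => K; rewrite !ffunE (bigD1 I) //= [X in _ + X]big1 ?addr0; last first.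
  move=> I' I'I; apply: big1 => J' _.
  by rewrite ffunE (negbTE I'I) mul0r scaler0.
have [->|KN] := eqVneq K; last first.
  apply: big1 => J' /eqP KE; rewrite !ffunE eqxx.
  have [J'E|_] := eqVneq J'; last by rewrite mulr0 scaler0.
  by rewrite -KE J'E eqxx in KN.
rewrite (bigD1 J) //= !ffunE !eqxx big1 ?addr0 // => J' /andP[_ J'J].
by rewrite !ffunE (negbTE J'J) mulr0 scaler0.
Qed.

Fact superfun_part_is_linear b : linear (part b).
Proof.
move=> a f g; apply/ffunP => K; rewrite !ffunE.
by case: eqP => // _; rewrite scaler0 addr0.
Qed.

HB.instance Definition _ b := GRing.isLinear.Build R SF SF *:%R
  (part b) (superfun_part_is_linear b).

Lemma superfun_part_smono b I phi :
  part b (smono I phi) = if odd #|I| == b then smono I phi else 0.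
Proof.
apply/ffunP => K; rewrite !ffunE; have [->|KI] := eqVneq K I.
  by case: eqP; rewrite ffunE ?eqxx.
by case: (_ == b); case: (_ == b); rewrite !ffunE ?(negbTE KI).
Qed.

Lemma superfun_part_part b c f : part b (part c f) = if b == c then part c f else 0.
Proof.
by apply/ffunP => K; rewrite !ffunE; case: b c => [] []; rewrite ?ffunE //=;
  case: odd; rewrite /= ?ffunE.
Qed.

Lemma superfun_part_sum f : f = part false f + part true f.
Proof.
by apply/ffunP => K; rewrite !ffunE; case: odd; rewrite ?addr0 ?add0r.
Qed.

Definition shom b f : Prop := part b f = f.

Lemma shom_part b f : shom b (part b f).
Proof. by rewrite /shom superfun_part_part eqxx. Qed.

Lemma shom0 b : shom b 0. Proof. exact: raddf0. Qed.

Lemma shomP b a f g : shom b f -> shom b g -> shom b (a *: f + g).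
Proof. by rewrite /shom linearP /= => -> ->. Qed.

Lemma shomD b f g : shom b f -> shom b g -> shom b (f + g).
Proof. by rewrite /shom raddfD /= => -> ->. Qed.

Lemma shomZ b a f : shom b f -> shom b (a *: f).
Proof. by rewrite /shom linearZ /= => ->. Qed.

Lemma shom_sum b (T : Type) (r : seq T) (P : pred T) (F : T -> SF) :
  (forall t, P t -> shom b (F t)) -> shom b (\sum_(t <- r | P t) F t).
Proof. by move=> H; rewrite /shom raddf_sum /=; apply: eq_bigr. Qed.

Lemma shom_partE b c f : shom b f -> part c f = if c == b then f else 0.
Proof.
by move=> fb; rewrite -{1}fb superfun_part_part; case: eqP => // ->.
Qed.

Lemma shom_smono I phi : shom (odd #|I|) (smono I phi).
Proof. by rewrite /shom superfun_part_smono eqxx. Qed.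

(** The projection to parity b fixes f and removes the terms of the other parity, so only terms of
    parity b have to be treated. *)
Lemma shom_ind b (P : SF -> Prop) : P 0 ->
  (forall f g, P f -> P g -> P (f + g)) ->
  (forall I phi, odd #|I| = b -> P (smono I phi)) ->
  forall f, shom b f -> P f.
Proof.
move=> P0 PD PI f fb; rewrite -fb (superfun_sum_smono f) raddf_sum /=.
apply: (big_ind P) => // I _; rewrite superfun_part_smono.
by case: eqP => // /PI.
Qed.

Lemma shomM b c f g : shom b f -> shom c g -> shom (b (+) c) (f * g).
Proof.
move=> fb gc; move: f fb; apply: shom_ind => [|f1 f2 H1 H2|I phi Ib].
- by rewrite mul0r; exact: shom0.
- by rewrite mulrDl; exact: shomD.
move: g gc; apply: shom_ind => [|g1 g2 H1 H2|J psi Jc].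
- by rewrite mulr0; exact: shom0.
- by rewrite mulrDr; exact: shomD.
rewrite smonoM /theta_sign; case: (boolP [disjoint I & J]) => [dIJ|_]; last first.
  by rewrite scale0r raddf0; exact: shom0.
by rewrite -Ib -Jc -oddD -card_disjU //; exact: shom_smono.
Qed.

Lemma shom_mulC b c f g : shom b f -> shom c g ->
  f * g = (-1) ^+ (b && c) *: (g * f).
Proof.
move=> fb gc; move: f fb; apply: shom_ind => [|f1 f2 H1 H2|I phi Ib].
- by rewrite mul0r mulr0 scaler0.
- by rewrite mulrDl mulrDr H1 H2 scalerDr.
move: g gc; apply: shom_ind => [|g1 g2 H1 H2|J psi Jc].
- by rewrite mul0r mulr0 scaler0.
- by rewrite mulrDl mulrDr H1 H2 scalerDr.
rewrite !smonoM finset.setUC -linearZ /= scalerA theta_signC Ib Jc.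
by rewrite mulrC [phi * psi]mulrC mulrC.
Qed.

Lemma even_coordE i : even_coord R n i = smono finset.set0 (smooth_coord R i).
Proof. by []. Qed.

Lemma odd_coordE j : odd_coord R m j = smono [set j]%SET 1.
Proof. by apply/ffunP => K; rewrite !ffunE; case: eqP. Qed.

Lemma superfun1E : 1 = smono finset.set0 1.
Proof. by apply/ffunP => K; rewrite !ffunE; case: eqP. Qed.

Lemma shom1 : shom false 1.
Proof. by have := shom_smono finset.set0 1; rewrite -superfun1E finset.cards0. Qed.

Lemma shom_even_coord i : shom false (even_coord R n i).
Proof.
by have := shom_smono finset.set0 (smooth_coord R i); rewrite finset.cards0.
Qed.

Lemma shom_odd_coord j : shom true (odd_coord R m j).
Proof. by have := shom_smono [set j]%SET 1; rewrite finset.cards1 -odd_coordE. Qed.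

Fact even_partial_is_linear i : linear (@even_partial R m n i).
Proof. by move=> a f g; apply/ffunP => K; rewrite !ffunE linearP. Qed.

HB.instance Definition _ i := GRing.isLinear.Build R SF SF *:%R
  (@even_partial R m n i) (even_partial_is_linear i).

Fact odd_partial_is_linear j : linear (@odd_partial R m n j).
Proof.
move=> a f g; apply/ffunP => K; rewrite !ffunE scalerDr !scalerA.
by rewrite [a * _]mulrC.
Qed.

HB.instance Definition _ j := GRing.isLinear.Build R SF SF *:%R
  (@odd_partial R m n j) (odd_partial_is_linear j).

Lemma even_partial_smono i I phi :
  even_partial i (smono I phi) = smono I (smooth_partial i phi).
Proof. by apply/ffunP => K; rewrite !ffunE; case: eqP; rewrite ?raddf0. Qed.

Lemma odd_partial_smono j I phi : odd_partial j (smono I phi) =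
  if j \in I then smono (I :\ j)%SET (theta_sign R [set j]%SET (I :\ j)%SET *: phi)
  else 0.
Proof.
apply/ffunP => K; rewrite ffunE [smono _ _ _]ffunE.
have [jK|jK] := boolP (j \in K).
  rewrite /theta_sign finset.disjoints_subset finset.sub1set finset.inE jK /= scale0r.
  case: ifP => _; rewrite ffunE //; case: eqP => // KE.
  by rewrite KE !finset.inE eqxx in jK.
have [<-|KI] := eqVneq (j |: K)%SET I.
  by rewrite finset.setU11 finset.setU1K // ffunE eqxx.
rewrite scaler0; case: ifP => jI; rewrite ffunE //; case: eqP => // KE.
by rewrite KE finset.setD1K ?eqxx in KI.
Qed.

Lemma even_partialM i f g :
  even_partial i (f * g) = even_partial i f * g + f * even_partial i g.
Proof.
rewrite (superfun_sum_smono f) (superfun_sum_smono g).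
elim/big_ind: _ => [|f1 f2 H1 H2|I _]; first by rewrite !mul0r raddf0 mul0r addr0.
  by rewrite !mulrDl !raddfD /= mulrDl H1 H2 addrACA.
elim/big_ind: _ => [|g1 g2 H1 H2|J _]; first by rewrite !mulr0 raddf0 mulr0 addr0.
  by rewrite !mulrDr !raddfD /= mulrDr H1 H2 addrACA.
rewrite !smonoM !even_partial_smono !smonoM linearZ /= smooth_partialM.
by rewrite scalerDr raddfD.
Qed.

Lemma odd_partialM c j f g : shom c f ->
  odd_partial j (f * g) = odd_partial j f * g + (-1) ^+ c *: (f * odd_partial j g).
Proof.
move=> fc; move: f fc; apply: shom_ind => [|f1 f2 H1 H2|I phi Ic].
- by rewrite !mul0r raddf0 mul0r scaler0 addr0.
- by rewrite !mulrDl !raddfD /= mulrDl H1 H2 ?scalerDr addrACA.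
rewrite (superfun_sum_smono g).
elim/big_ind: _ => [|g1 g2 H1 H2|J _].
- by rewrite !mulr0 raddf0 mulr0 scaler0 addr0.
- by rewrite !mulrDr !raddfD /= ?mulrDr ?scalerDr H1 H2 addrACA.
have del (K : {set 'I_n}) : j \in K -> exists2 K' : {set 'I_n}, j \notin K' & K = (j |: K')%SET.
  by move=> jK; exists (K :\ j)%SET; rewrite ?finset.setD11 ?finset.setD1K.
rewrite smonoM !odd_partial_smono finset.inE.
have [jI|jI] := boolP (j \in I); have [jJ|jJ] := boolP (j \in J) => /=.
(* When both factors contain theta_j their product is 0, and the two terms on the right cancel by
   [theta_sign_ins2]. *)
- have [I' jI' IE] := del _ jI; have [J' jJ' JE] := del _ jJ.
  have -> : theta_sign R I J = 0.
    by rewrite /theta_sign; case: ifP => // /disjointFr/(_ jI); rewrite jJ.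
  rewrite scale0r scaler0 raddf0 -Ic; subst I J.
  rewrite !finset.setU1K // !smonoM -!scalerAr -!scalerAl !scalerA.
  rewrite finset.setUCA finset.setUA -linearZ -raddfD /= scalerA -scalerDl.
  rewrite [X in X + _]mulrC theta_sign_ins2 // finset.cardsU1 jI' /= signrN signr_odd.
  by rewrite mulNr add0n [X in _ - _ * X]mulrC subrr scale0r raddf0.
- have [I' jI' IE] := del _ jI; subst I.
  rewrite -finset.setUA !finset.setU1K ?finset.inE ?negb_or ?jI' // mulr0 scaler0 addr0.
  by rewrite smonoM -scalerAl !scalerA theta_sign_insl // [X in smono _ (X *: _)]mulrC.
- have [J' jJ' JE] := del _ jJ; subst J.
  rewrite finset.setUCA !finset.setU1K ?finset.inE ?negb_or ?jI // mul0r add0r.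
  rewrite smonoM -scalerAr !scalerA theta_sign_insr // -linearZ /= scalerA.
  by rewrite -Ic signr_odd [X in _ * X]mulrC.
- by rewrite mul0r mulr0 scaler0 addr0.
Qed.

End SuperfunAlgebra.

(** * Linear operators on superfunctions as an associative superalgebra *)

Section Operators.
Variables (R : realType) (m n : nat).
Local Notation SF := (superfun R m n).
Local Notation part := (@superfun_part R m n).
Implicit Types (b c d : bool) (f g h : SF) (X Y Z : SF -> SF).

(** Operators are bare functions with linearity as a hypothesis; replacing one by a bundled linear
    map makes the generic rewriting rules for sums and scalars applicable to it. *)
Lemma linear_pack X : linear X -> exists X' : {linear SF -> SF}, X = X'.
Proof.
move=> linX; pose linM := GRing.isLinear.Build R SF SF *:%R X linX.
pose X' : {linear SF -> SF} := HB.pack X linM.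
by exists X'.
Qed.

Lemma fun_combE a X Y f : (a *: X + Y) f = a *: X f + Y f.
Proof. by []. Qed.

Lemma linear_0 : linear (0 : SF -> SF).
Proof.
have E f : (0 : SF -> SF) f = 0 by [].
by move=> a f g; rewrite !E scaler0 addr0.
Qed.

Lemma linear_comb a X Y : linear X -> linear Y -> linear (a *: X + Y).
Proof.
move=> lX lY k f g; rewrite !fun_combE lX lY !scalerDr !scalerA [a * k]mulrC.
by rewrite addrACA.
Qed.

Lemma linear_comp X Y : linear X -> linear Y -> linear (X \o Y).
Proof. by move=> lX lY k f g; rewrite /= lY lX. Qed.

Lemma op_part_comb b a X Y :
  op_part b (a *: X + Y) = a *: op_part b X + op_part b Y.
Proof.
apply/funext => f; rewrite !fun_combE /op_part scaler_sumr -big_split /=.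
by apply: eq_bigr => c _; rewrite linearP.
Qed.

Lemma op_part_linear b X : linear X -> linear (op_part b X).
Proof.
move=> lX a f g; rewrite /op_part scaler_sumr -big_split /=.
by apply: eq_bigr => c _; rewrite linearP lX linearP.
Qed.

Lemma op_part_shomE b c X f : linear X -> shom c f ->
  op_part b X f = part (b (+) c) (X f).
Proof.
move=> /linear_pack[X' ->] fc; rewrite /op_part (bigD1 c) //= fc.
rewrite big1 ?addr0 // => c' c'c.
by rewrite (shom_partE c' fc) (negbTE c'c) !raddf0.
Qed.

Lemma op_part_shom b c X f : linear X -> shom c f -> shom (b (+) c) (op_part b X f).
Proof. by move=> lX fc; rewrite (op_part_shomE _ lX fc); exact: shom_part. Qed.

Lemma eq_op_linear X Y : linear X -> linear Y ->
  (forall c f, shom c f -> X f = Y f) -> X = Y.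
Proof.
move=> /linear_pack[X' ->] /linear_pack[Y' ->] XY; apply/funext => f.
rewrite (superfun_part_sum f) !raddfD /=.
by rewrite (XY false) ?(XY true) //; exact: shom_part.
Qed.

Lemma op_partP b X : linear X ->
  (forall c f, shom c f -> shom (b (+) c) (X f)) -> op_part b X = X.
Proof.
move=> lX hX; apply: eq_op_linear => [||c f fc] //; first exact: op_part_linear.
by rewrite (op_part_shomE _ lX fc) hX.
Qed.

Lemma op_part_fix b c X f : linear X -> op_part b X = X -> shom c f ->
  shom (b (+) c) (X f).
Proof. by move=> lX <-; exact: op_part_shom. Qed.

Lemma op_part_part b c X : linear X ->
  op_part b (op_part c X) = if b == c then op_part c X else 0.
Proof.
move=> lX; have lcX := op_part_linear c lX.
case: eqP => [->|bc]; first by apply: op_partP => // d f; exact: op_part_shom.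
apply: eq_op_linear; [exact: op_part_linear|exact: linear_0|move=> d f fd].
rewrite (op_part_shomE _ lcX fd) (shom_partE _ (op_part_shom c lX fd)).
by case: eqP => // /addIb.
Qed.

Lemma op_part_sum X : linear X -> X = op_part false X + op_part true X.
Proof.
move=> lX; apply: eq_op_linear => //.
  by rewrite -[op_part false X]scale1r; apply: linear_comb; exact: op_part_linear.
move=> c f fc; rewrite [RHS]/(_ + _) !(op_part_shomE _ lX fc) [LHS]superfun_part_sum.
by case: c fc => _ //=; rewrite addrC.
Qed.

Lemma op_part_comp b c X Y : linear X -> linear Y ->
  op_part b X = X -> op_part c Y = Y -> op_part (b (+) c) (X \o Y) = X \o Y.
Proof.
move=> lX lY Xb Yc; apply: op_partP => [|d f fd]; first exact: linear_comp.
by rewrite -addbA; exact: op_part_fix lX Xb (op_part_fix lY Yc fd).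
Qed.

Lemma comp_combr a X Y Z : linear X ->
  X \o (a *: Y + Z) = a *: (X \o Y) + (X \o Z).
Proof. by move=> lX; apply/funext => f; rewrite /= !fun_combE lX. Qed.

Definition linear_ops : set (operator_space R m n) :=
  [set X | linear (X : SF -> SF)]%classic.

(** Composition is linear in its left argument for arbitrary functions, but in its right argument
    only when the left one is linear; this is the asymmetry between [sc_mulPl] and [sc_mulPr]. *)
Lemma linear_ops_supercommutator :
  is_supercommutator linear_ops (fun X Y => X \o Y).
Proof.
split=> //=.
- exact: linear_0.
- by move=> a x y; exact: linear_comb.
- by move=> b x; exact: op_part_linear.
- by move=> x y; exact: linear_comp.
- by move=> b a x y; exact: op_part_comb.
- by move=> b c x; exact: op_part_part.
- by move=> x; exact: op_part_sum.
- by move=> a x y z; exact: comp_combr.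
- by move=> b c x y; exact: op_part_comp.
Qed.

Lemma op_bracket_homogeneous b c X Y : linear X -> linear Y ->
  op_part b X = X -> op_part c Y = Y ->
  op_bracket X Y = (X \o Y) - (-1) ^+ (b && c) *: (Y \o X).
Proof. exact: (bracket_homogeneous linear_ops_supercommutator). Qed.

End Operators.

(** * Superderivations and the chain rule *)

Section Superderivations.
Variables (R : realType) (m n : nat).
Local Notation SF := (superfun R m n).
Local Notation iota := (@smono R m n finset.set0).
Implicit Types (b c d : bool) (f g h : SF) (X Y Z : SF -> SF).
Implicit Types (phi psi : smoothfun R m) (i : 'I_m) (j : 'I_n).

(** The Koszul sign requires a parity for X, so this is the homogeneous notion; a vector field is
    handled through its two parts by [vector_fieldP]. *)
Record superderivation b X : Prop := Superderivation {
  superder_linear : linear X;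
  superder_shom : forall c f, shom c f -> shom (b (+) c) (X f);
  superderM : forall c f g, shom c f ->
    X (f * g) = X f * g + (-1) ^+ (b && c) *: (f * X g) }.

Lemma superder_op_part b c X : superderivation b X ->
  op_part c X = if c == b then X else 0.
Proof.
move=> dX; have lX := superder_linear dX.
have XE := op_partP lX (superder_shom dX).
by rewrite -{1}XE op_part_part // XE; case: eqP => // ->.
Qed.

Lemma vector_fieldP X : vector_field X <->
  linear X /\ forall b, superderivation b (op_part b X).
Proof.
split=> [[lX MX]|[lX dX]].
  split=> // b; split=> [|c f|c f g fc]; first exact: op_part_linear.
    exact: op_part_shom.
  exact: MX.
by split=> // b c f g fc; apply: superderM.
Qed.

Lemma superder_vector_field b X : superderivation b X -> vector_field X.
Proof.
move=> dX; apply/vector_fieldP; split=> [|c]; first exact: superder_linear dX.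
rewrite (superder_op_part c dX); case: eqP => [->//|_].
split=> [|d f fd|d f g fd]; first exact: linear_0.
  exact: shom0.
by rewrite /= mul0r mulr0 scaler0 addr0.
Qed.

Lemma superder0 b : superderivation b (0 : SF -> SF).
Proof.
split=> [|d f fd|d f g fd]; first exact: linear_0.
  exact: shom0.
by rewrite /= mul0r mulr0 scaler0 addr0.
Qed.

Lemma superder_comb b a X Y : superderivation b X -> superderivation b Y ->
  superderivation b (a *: X + Y).
Proof.
move=> dX dY; split=> [|c f fc|c f g fc].
- by apply: linear_comb; [exact: superder_linear dX|exact: superder_linear dY].
- by rewrite fun_combE; apply: shomP; [exact: superder_shom dX _ _ fc|exact: superder_shom dY _ _ fc].
rewrite !fun_combE (superderM dX _ fc) (superderM dY _ fc).
rewrite mulrDl mulrDr !scalerDr -scalerAl -scalerAr !scalerA [a * _]mulrC.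
by rewrite addrACA.
Qed.

Lemma superderD b X Y : superderivation b X -> superderivation b Y ->
  superderivation b (X + Y).
Proof. by move=> dX dY; rewrite -[X]scale1r; exact: superder_comb. Qed.

Lemma superder_sum b (T : Type) (r : seq T) (P : pred T) (F : T -> SF -> SF) :
  (forall t, P t -> superderivation b (F t)) ->
  superderivation b (\sum_(t <- r | P t) F t).
Proof.
move=> dF; apply: (big_ind (superderivation b)) => //; first exact: superder0.
by move=> X Y; exact: superderD.
Qed.

Lemma superder_mul b c f X : shom c f -> superderivation b X ->
  superderivation (c (+) b) (fun g => f * X g).
Proof.
move=> fc dX; split=> [a g h|d g gd|d g h gd].
- by rewrite (superder_linear dX) mulrDr -scalerAr.
- by rewrite -addbA; apply: shomM => //; exact: superder_shom dX _ _ gd.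
rewrite (superderM dX _ gd) mulrDr mulrA -scalerAr !mulrA.
rewrite (shom_mulC fc gd) -!scalerAl scalerA.
congr (_ + _ *: _).
by case: b c d {dX fc gd} => [] [] []; rewrite /= ?mulr1 ?mulrNN ?mulr1 ?mul1r.
Qed.

Lemma fun_commE a X Y f :
  ((X \o Y) - a *: (Y \o X)) f = X (Y f) - a *: Y (X f).
Proof. by []. Qed.

(** The mixed products X f * Y g and Y f * X g each arise from both compositions, and the sign in
    the supercommutator makes them cancel. *)
Lemma superder_comm b c X Y : superderivation b X -> superderivation c Y ->
  superderivation (b (+) c) ((X \o Y) - (-1) ^+ (b && c) *: (Y \o X)).
Proof.
move=> dX dY; have lX := superder_linear dX; have lY := superder_linear dY.
have lXY := linear_comp lX lY; have lYX := linear_comp lY lX.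
rewrite addrC -scaleNr; split=> [|d f fd|d f g fd].
- exact: linear_comb.
- rewrite fun_combE; apply: shomP => /=.
    rewrite [b (+) c]addbC -addbA.
    by apply: superder_shom dY _ _ _; exact: superder_shom dX _ _ fd.
  by rewrite -addbA; apply: superder_shom dX _ _ _; exact: superder_shom dY _ _ fd.
rewrite !fun_combE /=.
have Xf := superder_shom dX fd; have Yf := superder_shom dY fd.
rewrite (superderM dX _ fd) (superderM dY _ fd).
have [X' XE] := linear_pack lX; have [Y' YE] := linear_pack lY.
have XD u v : X (u + v) = X u + X v by rewrite XE raddfD.
have YD u v : Y (u + v) = Y u + Y v by rewrite YE raddfD.
have XZ a u : X (a *: u) = a *: X u by rewrite XE linearZ.
have YZ a u : Y (a *: u) = a *: Y u by rewrite YE linearZ.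
rewrite XD YD XZ YZ (superderM dX _ fd) (superderM dY _ fd).
rewrite (superderM dX _ Yf) (superderM dY _ Xf).
rewrite mulrDl mulrDr -!scalerAl -!scalerAr.
move: (X f * Y g) (Y f * X g) (X (Y f) * g) (Y (X f) * g) (f * X (Y g)) (f * Y (X g)).
move=> A B C E F G.
have -> : (-1 : R) ^+ (b && (c (+) d)) = (-1) ^+ (b && c) * (-1) ^+ (b && d).
  by case: (b) (c) (d) => [] [] []; rewrite /= ?mulrNN ?mulr1 ?mul1r.
have -> : (-1 : R) ^+ (c && (b (+) d)) = (-1) ^+ (b && c) * (-1) ^+ (c && d).
  by case: (b) (c) (d) => [] [] []; rewrite /= ?mulrNN ?mulr1 ?mul1r.
have -> : (-1 : R) ^+ ((b (+) c) && d) = (-1) ^+ (b && d) * (-1) ^+ (c && d).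
  by case: (b) (c) (d) => [] [] []; rewrite /= ?mulrNN ?mulr1 ?mul1r.
have : (-1 : R) ^+ (b && c) * (-1) ^+ (b && c) = 1 by rewrite -expr2 sqrr_sign.
move: ((-1) ^+ (b && c)) ((-1) ^+ (b && d)) ((-1) ^+ (c && d)) => p q r pp.
rewrite !scalerDr !scalerA !mulNr !mulrN [p * (p * r)]mulrA pp mul1r !scaleNr -!opprD.
rewrite [q * r]mulrC [r * q * p]mulrC [p * (r * q)]mulrCA mulrA.
rewrite -[p * q * r]mulrA [q * r]mulrC [r * p * q]mulrAC [r * q * p]mulrC.
move: (r *: A) (_ *: B) (p *: E) (r * q *: F) (_ *: G) => A1 B1 E1 F1 G1.
rewrite [in LHS]addrC opprD addrACA [C + B1 + _]addrC.
rewrite [- (E1 + A1)]opprD [- E1 - A1 + _]addrACA opprD [A1 + F1 + _]addrACA.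
have cancel (u v : SF) : u + (- A1 + B1) + (A1 - B1 + v) = u + v.
  rewrite -addrA; congr (_ + _); rewrite addrA [- A1 + B1 + _]addrACA.
  by rewrite addNr subrr addr0 add0r.
by rewrite cancel [F1 - G1]addrC.
Qed.

Lemma op_bracket_superder b c X Y : superderivation b X -> superderivation c Y ->
  op_bracket X Y = (X \o Y) - (-1) ^+ (b && c) *: (Y \o X).
Proof.
move=> dX dY; have lX := superder_linear dX; have lY := superder_linear dY.
apply: op_bracket_homogeneous => //.
  by rewrite (superder_op_part _ dX) eqxx.
by rewrite (superder_op_part _ dY) eqxx.
Qed.

Lemma vector_field_comb a X Y : vector_field X -> vector_field Y ->
  vector_field (a *: X + Y).
Proof.
move=> /vector_fieldP[lX dX] /vector_fieldP[lY dY]; apply/vector_fieldP.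
split=> [|b]; first exact: linear_comb.
by rewrite op_part_comb; exact: superder_comb.
Qed.

Lemma superder_even_partial i : superderivation false (@even_partial R m n i).
Proof.
split=> [|c f|c f g _]; [exact: linearP| |].
  move: f; apply: shom_ind => [|f g Hf Hg|I phi Ic].
  - by rewrite raddf0; exact: shom0.
  - by rewrite raddfD; exact: shomD.
  by rewrite even_partial_smono -Ic; exact: shom_smono.
by rewrite even_partialM scale1r.
Qed.

Lemma superder_odd_partial j : superderivation true (@odd_partial R m n j).
Proof.
split=> [|c f|c f g fc]; [exact: linearP| |exact: odd_partialM].
move: f; apply: shom_ind => [|f g Hf Hg|I phi Ic].
- by rewrite raddf0; exact: shom0.
- by rewrite raddfD; exact: shomD.
rewrite odd_partial_smono; case: ifP => jI; last exact: shom0.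
have := cardsD1 j I; rewrite jI add1n => IE.
by rewrite -Ic IE /= negbK; exact: shom_smono.
Qed.

(* For a superderivation, X f = \sum_u X(u) * d_u f over all the coordinates u
   follows from this property, which only involves f = phi without thetas. *)
Definition chain_rule X : Prop := forall phi,
  X (iota phi) = \sum_i X (even_coord R n i) * iota (smooth_partial i phi).

Lemma chain_rule0 : chain_rule 0.
Proof. by move=> phi; rewrite big1 // => i _; rewrite mul0r. Qed.

Lemma chain_rule_comb a X Y : chain_rule X -> chain_rule Y ->
  chain_rule (a *: X + Y).
Proof.
move=> cX cY phi; rewrite fun_combE cX cY scaler_sumr -big_split /=.
by apply: eq_bigr => i _; rewrite fun_combE mulrDl scalerAl.
Qed.

Lemma chain_rule_mul f X : chain_rule X -> chain_rule (fun g => f * X g).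
Proof.
move=> cX phi; rewrite cX mulr_sumr; apply: eq_bigr => i _.
by rewrite mulrA.
Qed.

Lemma chain_rule_sum (T : Type) (r : seq T) (P : pred T) (F : T -> SF -> SF) :
  (forall t, P t -> chain_rule (F t)) -> chain_rule (\sum_(t <- r | P t) F t).
Proof.
move=> cF; apply: (big_ind chain_rule) => //; first exact: chain_rule0.
by move=> X Y cX cY; rewrite -[X]scale1r; exact: chain_rule_comb.
Qed.

Lemma even_partial_even_coord i k :
  even_partial i (even_coord R n k) = (i == k)%:R.
Proof.
rewrite even_coordE even_partial_smono smooth_partial_coord.
by case: eqP => _; rewrite ?raddf0 // superfun1E.
Qed.

Lemma even_partial_odd_coord i j : even_partial i (odd_coord R m j) = 0.
Proof. by rewrite odd_coordE even_partial_smono smooth_partial1 raddf0. Qed.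

Lemma odd_partial_iota j phi : odd_partial j (iota phi) = 0.
Proof. by rewrite odd_partial_smono finset.inE. Qed.

Lemma odd_partial_even_coord j i : odd_partial j (even_coord R n i) = 0.
Proof. exact: odd_partial_iota. Qed.

Lemma odd_partial_odd_coord j k :
  odd_partial j (odd_coord R m k) = (j == k)%:R.
Proof.
rewrite odd_coordE odd_partial_smono finset.inE; case: eqP => // ->.
by rewrite finset.setDv theta_sign0r scale1r superfun1E.
Qed.

Lemma superder1 b X : superderivation b X -> X 1 = 0.
Proof.
move=> dX; have := superderM dX 1 (shom1 R m n).
rewrite andbF scale1r !mulr1 mul1r.
by move/(congr1 (fun h => h - X 1)); rewrite addrK subrr.
Qed.

Lemma chain_rule_even_partial i : chain_rule (@even_partial R m n i).
Proof.
move=> phi; rewrite even_partial_smono (bigD1 i) //= even_partial_even_coord.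
rewrite eqxx mul1r big1 ?addr0 // => k ki.
by rewrite even_partial_even_coord eq_sym (negbTE ki) mul0r.
Qed.

Lemma chain_rule_odd_partial j : chain_rule (@odd_partial R m n j).
Proof.
move=> phi; rewrite odd_partial_iota big1 // => i _.
by rewrite odd_partial_even_coord mul0r.
Qed.

(* The second derivatives cancel in the supercommutator, as partial derivatives
   commute. *)
Lemma chain_rule_comm b c X Y : superderivation b X -> superderivation c Y ->
  chain_rule X -> chain_rule Y ->
  chain_rule ((X \o Y) - (-1) ^+ (b && c) *: (Y \o X)).
Proof.
move=> dX dY cX cY phi.
have chain2 b' c' U V : superderivation b' U -> superderivation c' V ->
    chain_rule U -> chain_rule V -> U (V (iota phi)) =
    \sum_i U (V (even_coord R n i)) * iota (smooth_partial i phi) +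
    (-1) ^+ (b' && c') *: \sum_i \sum_k V (even_coord R n i) * (U (even_coord R n k) *
      iota (smooth_partial k (smooth_partial i phi))).
  move=> dU dV cU cV; have [U' UE] := linear_pack (superder_linear dU).
  rewrite cV {1}UE raddf_sum /= -UE scaler_sumr -big_split /=.
  apply: eq_bigr => i _; have Vi := superder_shom dV (shom_even_coord R n i).
  by rewrite (superderM dU _ Vi) addbF cU mulr_sumr.
rewrite fun_commE (chain2 _ _ _ _ dX dY cX cY) (chain2 _ _ _ _ dY dX cY cX).
rewrite [c && b]andbC scalerDr scalerA -expr2 sqrr_sign scale1r.
rewrite [X in X - _]addrC [X in _ - X]addrC opprD addrACA.
rewrite [X in X + _](_ : _ = 0) ?add0r; last first.
  apply/eqP; rewrite subr_eq0 exchange_big scaler_sumr; apply/eqP.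
  apply: eq_bigr => k _; rewrite scaler_sumr; apply: eq_bigr => i _.
  have Xk := superder_shom dX (shom_even_coord R n k).
  have Yi := superder_shom dY (shom_even_coord R n i).
  rewrite smooth_partialC !mulrA (shom_mulC Yi Xk) !addbF scalerAl scalerA.
  by rewrite [c && b]andbC -expr2 sqrr_sign scale1r.
rewrite scaler_sumr -sumrB; apply: eq_bigr => i _.
by rewrite fun_commE mulrBl scalerAl.
Qed.

(** Induction on the number of odd factors: up to a sign, a term is theta_j times a shorter term,
    and the Leibniz rule reduces the claim to these two. *)
Lemma eq_superder b X Y : superderivation b X -> superderivation b Y ->
  (forall phi, X (iota phi) = Y (iota phi)) ->
  (forall j, X (odd_coord R m j) = Y (odd_coord R m j)) -> X = Y.
Proof.
move=> dX dY XYi XYo.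
apply: (eq_op_linear (superder_linear dX) (superder_linear dY)) => c.
have [X' XE] := linear_pack (superder_linear dX).
have [Y' YE] := linear_pack (superder_linear dY).
apply: shom_ind => [|f g Xf Xg|I phi _].
- by rewrite XE YE !raddf0.
- by rewrite XE YE !raddfD /= -XE -YE Xf Xg.
have [k] := ubnP #|I|; elim: k I phi => // k IHk I phi Ik.
have [->//|[j jI]] := set_0Vmem I.
have jI' : j \notin (I :\ j)%SET by rewrite finset.setD11.
have Ek : (#|(I :\ j)%SET| < k)%N by move: Ik; rewrite (finset.cardsD1 j) jI.
pose s := theta_sign R [set j]%SET (I :\ j)%SET.
have ss : s * s = 1.
  by apply: theta_sign_sqr; rewrite finset.disjoints_subset finset.sub1set finset.inE.
have -> : smono I phi = s *: (odd_coord R m j * smono (I :\ j)%SET phi) :> SF.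
  rewrite odd_coordE smonoM finset.setD1K // -linearZ /= scalerA ss scale1r.
  by rewrite mul1r.
have IH := IHk _ phi Ek.
rewrite {1}XE {1}YE !linearZ /= -XE -YE.
rewrite (superderM dX _ (shom_odd_coord R m j)) (superderM dY _ (shom_odd_coord R m j)).
by rewrite IH XYo.
Qed.

Lemma eq_superder_coord b X Y : superderivation b X -> superderivation b Y ->
  chain_rule X -> chain_rule Y ->
  (forall i, X (even_coord R n i) = Y (even_coord R n i)) ->
  (forall j, X (odd_coord R m j) = Y (odd_coord R m j)) -> X = Y.
Proof.
move=> dX dY cX cY XYe; apply: (eq_superder dX dY) => phi.
by rewrite cX cY; apply: eq_bigr => i _; rewrite XYe.
Qed.

End Superderivations.

(** * Parity of block matrices and Koszul signs in matrix form *)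

Section GeneralLinear.
Variables (R : realType) (p n : nat).
Local Notation M := 'M[R]_(p + n).
Implicit Types (b c : bool) (A B X : M) (i j k : 'I_(p + n)).

Definition idx_odd i : bool := (p <= i)%N.

Lemma idx_odd_lshift (i : 'I_p) : idx_odd (lshift n i) = false.
Proof. by rewrite /idx_odd leqNgt /= ltn_ord. Qed.

Lemma idx_odd_rshift (j : 'I_n) : idx_odd (rshift p j) = true.
Proof. by rewrite /idx_odd /= leq_addr. Qed.

Lemma gl_partE b A i j :
  gl_part b A i j = if idx_odd i (+) idx_odd j == b then A i j else 0.
Proof.
rewrite /gl_part; case: b; case: (split_ordP i) => i' ->; case: (split_ordP j) => j' ->;
  rewrite ?idx_odd_lshift ?idx_odd_rshift /=;
  by rewrite ?block_mxEul ?block_mxEur ?block_mxEdl ?block_mxEdr ?mxE ?lshift0.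
Qed.

Lemma vec_partE b (U : 'cV[R]_(p + n)) i (k : 'I_1) :
  vec_part b U i k = if idx_odd i == b then U i k else 0.
Proof.
rewrite /vec_part; case: b; case: (split_ordP i) => i' ->;
  by rewrite ?idx_odd_lshift ?idx_odd_rshift /= ?col_mxEu ?col_mxEd ?mxE.
Qed.

Lemma gl_part_comb b (a : R) A B :
  gl_part b (a *: A + B) = a *: gl_part b A + gl_part b B.
Proof.
apply/matrixP => i j; rewrite gl_partE !mxE !gl_partE.
by case: ifP => // _; rewrite mulr0 addr0.
Qed.

Lemma gl_part_part b c A :
  gl_part b (gl_part c A) = if b == c then gl_part c A else 0.
Proof.
apply/matrixP => i j; rewrite !gl_partE (fun_if (fun X : M => X i j)) gl_partE mxE.
by case: (idx_odd i) (idx_odd j) b c => [] [] [] [].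
Qed.

Lemma gl_part_sum A : A = gl_part false A + gl_part true A.
Proof.
apply/matrixP => i j; rewrite mxE !gl_partE.
by case: (idx_odd i) (idx_odd j) => [] []; rewrite /= ?addr0 ?add0r.
Qed.

Lemma gl_part_eq0 b A i j : gl_part b A = A ->
  idx_odd i (+) idx_odd j != b -> A i j = 0.
Proof. by move=> <- /negbTE ij; rewrite gl_partE ij. Qed.

Lemma gl_part_mul b c A B : gl_part b A = A -> gl_part c B = B ->
  gl_part (b (+) c) (A *m B) = A *m B.
Proof.
move=> Ab Bc; apply/matrixP => i j; rewrite gl_partE; case: eqP => // /eqP ij.
rewrite mxE big1 // => k _.
have [ik|/(gl_part_eq0 Ab)->] := eqVneq (idx_odd i (+) idx_odd k) b; last by rewrite mul0r.
have [kj|/(gl_part_eq0 Bc)->] := eqVneq (idx_odd k (+) idx_odd j) c; last by rewrite mulr0.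
by case/eqP: ij; rewrite -ik -kj; case: (idx_odd i) (idx_odd j) (idx_odd k) => [] [] [].
Qed.

Lemma gl_supercommutator : is_supercommutator (L := gl_space R p n) setT mulmx.
Proof.
split=> //=.
- by move=> b a x y; exact: gl_part_comb.
- by move=> b c x _; exact: gl_part_part.
- by move=> x _; exact: gl_part_sum.
- by move=> a x y z; rewrite mulmxDl scalemxAl.
- by move=> a x y z _; rewrite mulmxDr scalemxAr.
- by move=> x y z; exact: mulmxA.
- by move=> b c x y _ _; exact: gl_part_mul.
Qed.

Lemma gl_part_tr b A : gl_part b A^T = (gl_part b A)^T.
Proof. by apply/matrixP => i j; rewrite mxE !gl_partE mxE addbC. Qed.

(** For odd b this is the grading operator, 1 on even and -1 on odd vectors. It turns a Koszul sign
    depending on the parity of a vector into a matrix factor. *)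
Definition parity_mx b : M := diag_mx (\row_i (-1) ^+ (b && idx_odd i)).

Lemma vec_part_signed_sum b (U : 'cV[R]_(p + n)) :
  \sum_(c : bool) (-1) ^+ (b && c) *: vec_part c U = parity_mx b *m U.
Proof.
apply/matrixP => i j; rewrite mul_diag_mx !mxE summxE.
under eq_bigr do rewrite mxE vec_partE; rewrite big_bool.
by case: (idx_odd i); rewrite /= ?mulr0 ?addr0 ?add0r.
Qed.

(** Each of the four parity blocks is rescaled by its own scalar. An even matrix is block diagonal,
    so multiplication by it commutes with such a rescaling; the parity projections and the signs of
    the transposed term in [spo_expression] are of this kind. *)
Definition twist_mx (s : bool -> bool -> R) A : M :=
  \matrix_(i, j) (s (idx_odd i) (idx_odd j) * A i j).

Lemma twist_mxl s C A : gl_part false C = C ->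
  C *m twist_mx s A = twist_mx s (C *m A).
Proof.
move=> C0; apply/matrixP => i j; rewrite !mxE mulr_sumr; apply: eq_bigr => k _.
rewrite mxE mulrCA; have [ik|ik] := eqVneq (idx_odd i) (idx_odd k); first by rewrite ik.
by rewrite (gl_part_eq0 C0) ?mul0r ?mulr0 //; case: (idx_odd i) (idx_odd k) ik => [] [].
Qed.

Lemma twist_mxr s C A : gl_part false C = C ->
  twist_mx s A *m C = twist_mx s (A *m C).
Proof.
move=> C0; apply/matrixP => i j; rewrite !mxE mulr_sumr; apply: eq_bigr => k _.
rewrite mxE mulrA; have [kj|kj] := eqVneq (idx_odd k) (idx_odd j); first by rewrite kj.
by rewrite (gl_part_eq0 C0 (i := k)) ?mulr0 //; case: (idx_odd k) (idx_odd j) kj => [] [].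
Qed.

Lemma gl_part_twist b A : gl_part b A = twist_mx (fun c d => (c (+) d == b)%:R) A.
Proof.
by apply/matrixP => i j; rewrite gl_partE mxE; case: ifP; rewrite ?mul1r ?mul0r.
Qed.

Lemma gl_part_mul_even b A C : gl_part false C = C ->
  gl_part b (A *m C) = gl_part b A *m C.
Proof. by move=> C0; rewrite !gl_part_twist twist_mxr. Qed.
Lemma parity_mxl b X i j : (parity_mx b *m X) i j = (-1) ^+ (b && idx_odd i) * X i j.
Proof. by rewrite mul_diag_mx !mxE. Qed.

Lemma parity_mxr b X i j : (X *m parity_mx b) i j = X i j * (-1) ^+ (b && idx_odd j).
Proof. by rewrite mul_mx_diag !mxE. Qed.

Lemma parity_mxM b c : parity_mx b *m parity_mx c = parity_mx (b (+) c).
Proof.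
apply/matrixP => i j; rewrite parity_mxl !mxE mulrnAr; congr (_ *+ _).
by case: b c (idx_odd i) => [] [] []; rewrite /= ?mulrNN ?mulr1 ?mul1r.
Qed.

Lemma parity_mxC b c A : gl_part b A = A ->
  A *m parity_mx c = (-1) ^+ (b && c) *: (parity_mx c *m A).
Proof.
move=> Ab; apply/matrixP => i j; rewrite parity_mxr mxE parity_mxl.
have [<-|/(gl_part_eq0 Ab)->] := eqVneq (idx_odd i (+) idx_odd j) b.
  rewrite mulrC mulrA; congr (_ * _).
  by case: c (idx_odd i) (idx_odd j) => [] [] []; rewrite /= ?mulrNN ?mulr1 ?mul1r.
by rewrite mul0r !mulr0.
Qed.

End GeneralLinear.

(** * The orthosymplectic Lie superalgebra as supersymmetric matrices *)

Section Spo.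
Variables (R : realType) (l n : nat).
Local Notation N := (l.+1 + l.+1 + n)%N.
Local Notation G := (spo_gram R l n).
Local Notation eps := (@parity_mx R (l.+1 + l.+1) n).
Local Notation odd i := (@idx_odd (l.+1 + l.+1) n i).
Implicit Types (b c : bool) (A B Q : 'M[R]_N) (i j k : 'I_N).

Lemma spo_gram_even i j : odd i != odd j -> G i j = 0.
Proof.
rewrite /spo_gram; case: (split_ordP i) => i' ->; case: (split_ordP j) => j' ->;
  rewrite ?idx_odd_lshift ?idx_odd_rshift // => _;
  by rewrite ?block_mxEur ?block_mxEdl mxE.
Qed.

Lemma spo_gram_part : gl_part false G = G.
Proof.
apply/matrixP => i j; rewrite gl_partE; case: eqP => // ij.
by rewrite spo_gram_even //; case: (odd i) (odd j) ij => [] [].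
Qed.

Lemma parity_mx_block : eps true = block_mx 1%:M 0 0 (- 1%:M).
Proof.
apply/matrixP => i j; case: (split_ordP i) => i' ->; case: (split_ordP j) => j' ->;
rewrite ?block_mxEul ?block_mxEur ?block_mxEdl ?block_mxEdr !mxE
  ?idx_odd_lshift ?idx_odd_rshift /= ?eq_lshift ?eq_rshift ?eq_lrshift ?eq_rlshift //.
by rewrite mulNrn.
Qed.

Lemma parity_mx0 : eps false = 1%:M.
Proof. by apply/matrixP => i j; rewrite !mxE. Qed.

Lemma spo_gram_sqr : G *m G = - eps true.
Proof.
rewrite parity_mx_block /spo_gram mulmx_block !mulmx0 !mul0mx !addr0 !add0r mulmx1.
rewrite mulmx_block !mulmx0 !mul0mx !addr0 !add0r !mulmx1 !mul1mx.
rewrite opp_block_mx !oppr0 opprK; congr (block_mx _ 0 0 _).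
by rewrite [X in _ = - X]scalar_mx_block opp_block_mx !oppr0.
Qed.

Lemma parity_gramC b : G *m eps b = eps b *m G.
Proof. by rewrite (parity_mxC _ spo_gram_part) scale1r. Qed.

Lemma spo_gram_tr : G^T = - (eps true *m G).
Proof.
rewrite parity_mx_block /spo_gram !tr_block_mx !trmx0 linearN /= !trmx1.
rewrite mulmx_block !mulmx0 !mul0mx !addr0 !add0r mul1mx mulmx1.
by rewrite !opp_block_mx !oppr0 !opprK.
Qed.

Lemma spo_gramV : G *m G^T = 1%:M.
Proof.
rewrite spo_gram_tr mulmxN mulmxA parity_gramC -mulmxA spo_gram_sqr.
by rewrite mulmxN opprK parity_mxM parity_mx0.
Qed.

Lemma spo_gramVl : G^T *m G = 1%:M.
Proof. exact: mulmx1C spo_gramV. Qed.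

(** The symmetry natural for the coefficients of a quadratic form in supercommuting variables:
    symmetric unless both indices are odd, antisymmetric then. *)
Definition supersymmetric Q : Prop :=
  forall i j, Q i j = (-1) ^+ (odd i && odd j) * Q j i.

Lemma mulmx_gram2 Q i j : (Q *m G *m G) i j = - ((-1) ^+ odd j * Q i j).
Proof.
by rewrite -mulmxA spo_gram_sqr mulmxN mxE parity_mxr mulrC.
Qed.

(** The parity sums collapse: the sum over c becomes a factor [parity_mx b] in front of U, and the
    sum over b turns these factors into block signs. The defining condition is thus the vanishing of
    a single matrix. *)
Lemma spo_expression A (U V : 'cV[R]_N) :
  \sum_(b : bool) \sum_(c : bool)
      (spo_form (gl_part b A *m vec_part c U) V +
       (-1) ^+ (b && c) * spo_form (vec_part c U) (gl_part b A *m V)) =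
  (V^T *m (G *m A + twist_mx (fun c d => (-1) ^+ ((c (+) d) && d)) (A^T *m G))
     *m U) 0 0.
Proof.
have -> : twist_mx (fun c d => (-1) ^+ ((c (+) d) && d)) (A^T *m G) =
    \sum_(b : bool) (gl_part b A)^T *m G *m eps b.
  under eq_bigr do rewrite -gl_part_tr -(gl_part_mul_even _ _ spo_gram_part).
  apply/matrixP => i j; rewrite big_bool mxE [RHS]mxE !parity_mxr !gl_partE.
  by case: (odd i) (odd j) => [] []; rewrite /= ?mul0r ?addr0 ?add0r mulrC.
pose f b c : R := spo_form (gl_part b A *m vec_part c U) V.
rewrite mulmxDr mulmxDl mxE mulmx_sumr mulmx_suml summxE.
have -> : (V^T *m (G *m A) *m U) 0 0 = \sum_(b : bool) \sum_(c : bool) f b c.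
  have UE : U = \sum_(c : bool) vec_part c U.
    rewrite -[LHS]mul1mx -parity_mx0 -vec_part_signed_sum.
    by apply: eq_bigr => c _; rewrite scale1r.
  have fU b : \sum_(c : bool) f b c = (V^T *m G *m gl_part b A *m U) 0 0.
    rewrite [in RHS]UE mulmx_sumr summxE; apply: eq_bigr => c _.
    by rewrite /f /spo_form !mulmxA.
  under eq_bigr do rewrite fU.
  rewrite -summxE -mulmx_suml -mulmx_sumr big_bool /= addrC -gl_part_sum.
  by rewrite !mulmxA.
rewrite -big_split /=; apply: eq_bigr => b _.
rewrite big_split /=; congr (_ + _).
rewrite -!mulmxA -vec_part_signed_sum !mulmx_sumr summxE; apply: eq_bigr => c _.
by rewrite -!scalemxAr mxE /spo_form trmx_mul !mulmxA.
Qed.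

Lemma mx_form_eq0 (M : 'M[R]_N) :
  (forall U V : 'cV[R]_N, (V^T *m M *m U) 0 0 = 0) -> M = 0.
Proof.
move=> M0; apply/matrixP => i j; rewrite mxE -(M0 (delta_mx j 0) (delta_mx i 0)).
by rewrite trmx_delta -rowE -colE !mxE.
Qed.

(** The matrix of [spo_expression] is multiplied by G^T on the left and G on the right, which is
    reversible as G G^T = 1. The first term becomes A G; in the second, G^2 = - [parity_mx true]
    produces minus the signed transpose of A G. *)
Lemma spoP A : spo A <-> supersymmetric (A *m G).
Proof.
pose M := G *m A + twist_mx (fun c d => (-1) ^+ ((c (+) d) && d)) (A^T *m G).
have -> : spo A <-> M = 0.
  split=> [SA|M0 U V]; last by rewrite spo_expression -/M M0 mulmx0 mul0mx mxE.
  by apply: mx_form_eq0 => U V; rewrite /M -spo_expression; exact: SA.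
have -> : M = 0 <-> G^T *m M *m G = 0.
  split=> [->|M0]; first by rewrite mulmx0 mul0mx.
  have := congr1 (fun X => G *m (X *m G^T)) M0.
  by rewrite mul0mx mulmx0 -!mulmxA spo_gramV mulmx1 mulmxA spo_gramV mul1mx.
rewrite /M mulmxDr mulmxA spo_gramVl mul1mx mulmxDl.
have GT0 : gl_part false G^T = G^T by rewrite gl_part_tr spo_gram_part.
rewrite twist_mxl // twist_mxr ?spo_gram_part // mulmxA -trmx_mul.
have E i j : (-1) ^+ ((odd i (+) odd j) && odd j) * ((A *m G)^T *m G *m G) i j =
    - ((-1) ^+ (odd i && odd j) * (A *m G) j i).
  rewrite mulmx_gram2 mulrN mulrA [in LHS]mxE; congr (- (_ * _)).
  by case: (odd i) (odd j) => [] []; rewrite /= ?mulrNN ?mulr1 ?mul1r.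
split=> [/matrixP H i j|H]; last apply/matrixP => i j.
  have := H i j; rewrite mxE [X in _ + X]mxE E [RHS]mxE => /eqP.
  by rewrite subr_eq0 => /eqP.
by rewrite mxE [X in _ + X]mxE E H subrr mxE.
Qed.

(** For homogeneous A the entrywise signs combine into one matrix identity that is stable under
    multiplication: it serves for products in [spo_bracket], and to exchange A G with G A^T in
    [gram_pairing_commutator]. *)
Lemma spo_homogeneousP b A : gl_part b A = A ->
  spo A <-> A *m G = - (eps b *m G *m A^T).
Proof.
move=> Ab; rewrite spoP.
have AE : A = A *m G *m G^T by rewrite -mulmxA spo_gramV mulmx1.
have E i j : (- (eps b *m G *m A^T)) i j = (-1) ^+ (odd i && odd j) * (A *m G) j i.
  rewrite [in LHS]AE trmx_mul trmxK mulmxA -[_ *m G *m G]mulmxA spo_gram_sqr.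
  rewrite mulmxN mulNmx opprK parity_mxM parity_mxl [in LHS]mxE.
  have [ij|ij] := eqVneq (odd j (+) odd i) b; last first.
    have AGb : gl_part b (A *m G) = A *m G.
      by rewrite gl_part_mul_even ?spo_gram_part // Ab.
    by rewrite (gl_part_eq0 AGb ij) !mulr0.
  by rewrite -ij; case: (odd i) (odd j) => [] [].
split=> [H|H i j]; last by rewrite {1}H E.
by apply/matrixP => i j; rewrite E H.
Qed.

Lemma spo_comb a A B : spo A -> spo B -> spo (a *: A + B).
Proof.
move=> /spoP SA /spoP SB; apply/spoP => i j.
rewrite mulmxDl -scalemxAl mxE [X in _ + X]SB mxE SA.
by rewrite [in RHS]mxE [X in _ * (X + _)]mxE mulrDr mulrCA.
Qed.

Lemma spo0 : spo (0 : 'M[R]_N).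
Proof. by apply/spoP => i j; rewrite mul0mx !mxE mulr0. Qed.

Lemma spo_part b A : spo A -> spo (gl_part b A).
Proof.
move=> /spoP SA; apply/spoP => i j.
rewrite -(gl_part_mul_even _ _ spo_gram_part) !gl_partE SA.
by rewrite [odd j (+) _]addbC; case: ifP; rewrite ?mulr0.
Qed.

Lemma spo_bracket A B : spo A -> spo B -> spo (gl_bracket A B).
Proof.
move=> SA SB; have spoD (X Y : 'M[R]_N) : spo X -> spo Y -> spo (X + Y).
  by move=> SX SY; rewrite -[X]scale1r; exact: spo_comb.
apply: (big_ind (@spo R l n)) => [|//|b _]; first exact: spo0.
apply: (big_ind (@spo R l n)) => [|//|c _]; first exact: spo0.
have := spo_part b SA; have := spo_part c SB.
have Ab : gl_part b (gl_part b A) = gl_part b A by rewrite gl_part_part eqxx.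
have Bc : gl_part c (gl_part c B) = gl_part c B by rewrite gl_part_part eqxx.
move: (gl_part b A) (gl_part c B) Ab Bc => {SA}A {SB}B Ab Bc.
move=> /(spo_homogeneousP Bc) SB /(spo_homogeneousP Ab) SA.
(* Moving G across a product of two elements transposes it and reverses the factors, with a sign
   symmetric in the two parities; the two terms of the supercommutator are thereby exchanged, which
   yields the identity required of it. *)
have prod_gram d e X Y : gl_part d X = X -> X *m G = - (eps d *m G *m X^T) ->
    Y *m G = - (eps e *m G *m Y^T) ->
    X *m Y *m G = (-1) ^+ (d && e) *: (eps (d (+) e) *m G *m (Y *m X)^T).
  move=> Xd SX SY; rewrite -mulmxA SY mulmxN !mulmxA (parity_mxC _ Xd).
  rewrite -!scalemxAl -[_ *m X *m G]mulmxA SX mulmxN mulNmx -scalerN opprK.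
  by rewrite trmx_mul !mulmxA parity_mxM addbC.
apply/(@spo_homogeneousP (b (+) c)).
  rewrite addrC -scaleNr gl_part_comb (gl_part_mul Ab Bc).
  by rewrite addbC (gl_part_mul Bc Ab).
rewrite mulmxBl -scalemxAl (prod_gram b c) // (prod_gram c b) // [c && b]andbC.
rewrite [c (+) b]addbC scalerA -expr2 sqrr_sign scale1r.
by rewrite linearB /= linearZ /= mulmxBr -scalemxAr opprB.
Qed.

Theorem spo_lie : is_lie_superalgebra (@spo R l n).
Proof.
apply: (super_bracket_lie (@gl_supercommutator R (l.+1 + l.+1) n)) => //.
- exact: spo0.
- exact: spo_comb.
- exact: spo_part.
- exact: spo_bracket.
Qed.

End Spo.

(** * The affine chart and the contact fields as superderivations *)

Section ContactFields.
Variables (R : realType) (l n : nat).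
Local Notation N := (l.+1 + l.+1 + n)%N.
Local Notation m := (1 + (l + l))%N.
Local Notation SF := (superfun R m n).
Local Notation G := (spo_gram R l n).
Local Notation odd i := (@idx_odd (l.+1 + l.+1) n i).
Local Notation z := (even_coord R n (z_idx l)).
Local Notation x i := (even_coord R n (x_idx i)).
Local Notation y i := (even_coord R n (y_idx i)).
Local Notation theta j := (odd_coord R m j).
Local Notation d_z := (@even_partial R m n (z_idx l)).
Implicit Types (b c : bool) (A B Q : 'M[R]_N) (f g h : SF) (X Y T : SF -> SF).

Definition one_index : 'I_N := lshift n (lshift l.+1 ord0).
Definition x_index (i : 'I_l) : 'I_N := lshift n (lshift l.+1 (lift ord0 i)).
Definition z_index : 'I_N := lshift n (rshift l.+1 ord0).
Definition y_index (i : 'I_l) : 'I_N := lshift n (rshift l.+1 (lift ord0 i)).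
Definition theta_index (j : 'I_n) : 'I_N := rshift (l.+1 + l.+1) j.

Lemma index_ind (P : 'I_N -> Prop) :
  P one_index -> (forall i, P (x_index i)) -> P z_index ->
  (forall i, P (y_index i)) -> (forall j, P (theta_index j)) -> forall a, P a.
Proof.
move=> P1 Px Pz Py Pt a; case: (split_ordP a) => [s ->|j ->]; last exact: Pt.
case: (split_ordP s) => [i|i] ->; case: (unliftP ord0 i) => [k|] ->;
  by [exact: Px|exact: P1|exact: Py|exact: Pz].
Qed.

(* The affine chart of R^(2l+2|n), in which the first homogeneous coordinate
   is 1. *)
Definition chart (a : 'I_N) : SF :=
  match fintype.split a with
  | inl s =>
    match fintype.split s with
    | inl i => if unlift ord0 i is Some k then x k else 1
    | inr i => if unlift ord0 i is Some k then y k else z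
    end
  | inr j => theta j
  end.

Local Notation w := chart.

Let splitl p q (i : 'I_p) : fintype.split (lshift q i) = inl i.
Proof. exact: (unsplitK (inl i)). Qed.
Let splitr p q (i : 'I_q) : fintype.split (rshift p i) = inr i.
Proof. exact: (unsplitK (inr i)). Qed.

Lemma chart_one : w one_index = 1.
Proof. by rewrite /chart !splitl unlift_none. Qed.
Lemma chart_x i : w (x_index i) = x i.
Proof. by rewrite /chart !splitl liftK. Qed.
Lemma chart_z : w z_index = z.
Proof. by rewrite /chart !(splitl, splitr) unlift_none. Qed.
Lemma chart_y i : w (y_index i) = y i.
Proof. by rewrite /chart !(splitl, splitr) liftK. Qed.
Lemma chart_theta j : w (theta_index j) = theta j.
Proof. by rewrite /chart !(splitl, splitr). Qed.

Definition chartE := (chart_one, chart_x, chart_z, chart_y, chart_theta).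

Lemma idx_oddE : (odd one_index = false) * (forall i, odd (x_index i) = false) *
  (odd z_index = false) * (forall i, odd (y_index i) = false) *
  (forall j, odd (theta_index j) = true).
Proof.
by do !split=> *; rewrite /one_index /x_index /z_index /y_index /theta_index
  ?idx_odd_lshift ?idx_odd_rshift.
Qed.

Lemma shom_chart a : shom (odd a) (w a).
Proof.
elim/index_ind: a => [|i||i|j]; rewrite idx_oddE chartE;
  by [exact: shom1|exact: shom_even_coord|exact: shom_odd_coord].
Qed.

Lemma sum_index (V : nmodType) (F : 'I_N -> V) : \sum_a F a =
  F one_index + \sum_i F (x_index i) + (F z_index + \sum_i F (y_index i)) +
  \sum_j F (theta_index j).
Proof. by rewrite big_split_ord /= big_split_ord /= !big_ord_recl. Qed.

(** Each row of the Gram matrix has a single nonzero entry: 1 is paired with z, x_i with y_i, and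
    theta_j with itself. *)
Lemma gramE :
  (forall b : 'I_N, G one_index b = - (b == z_index)%:R) *
  (forall i (b : 'I_N), G (x_index i) b = - (b == y_index i)%:R) *
  (forall b : 'I_N, G z_index b = (b == one_index)%:R) *
  (forall i (b : 'I_N), G (y_index i) b = (b == x_index i)%:R) *
  (forall j (b : 'I_N), G (theta_index j) b = (b == theta_index j)%:R).
Proof.
rewrite /spo_gram /one_index /x_index /z_index /y_index /theta_index.
split; [split; [split; [split; [move=> b|move=> i b]|move=> b]|move=> i b]|move=> j b];
elim/index_ind: b => [|k||k|k];
rewrite /one_index /x_index /z_index /y_index /theta_index
  ?block_mxEul ?block_mxEur ?block_mxEdl ?block_mxEdr ?block_mxEul ?block_mxEur ?block_mxEdl ?block_mxEdr
  ?mxE ?eq_lshift ?eq_rshift ?eq_lrshift ?eq_rlshift ?oppr0 // 1?eq_sym //.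
Qed.

Definition frame_x (i : 'I_l) f : SF := even_partial (x_idx i) f + y i * d_z f.
Definition frame_y (i : 'I_l) f : SF := even_partial (y_idx i) f - x i * d_z f.
Definition frame_theta (j : 'I_n) f : SF := odd_partial j f - theta j * d_z f.

Lemma contact_frame_x i : @contact_frame R l n (lshift n (lshift l i)) = frame_x i.
Proof. by rewrite /contact_frame !splitl. Qed.
Lemma contact_frame_y i : @contact_frame R l n (lshift n (rshift l i)) = frame_y i.
Proof. by rewrite /contact_frame splitl splitr. Qed.
Lemma contact_frame_theta j : @contact_frame R l n (rshift (l + l) j) = frame_theta j.
Proof. by rewrite /contact_frame splitr. Qed.

(** The double sum of X_f with only the nonzero entries of [contact_omega] kept. Here b is the
    parity of f, and its sign affects the odd frame fields only. *)
Definition frame_pairing b f g : SF :=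
  \sum_(i < l) (frame_y i f * frame_x i g - frame_x i f * frame_y i g) +
  (-1) ^+ b *: \sum_(j < n) frame_theta j f * frame_theta j g.

Lemma frame_pairingE b f g :
  \sum_r \sum_s ((-1) ^+ (b && contact_frame_odd r) * contact_omega R l n r s) *:
    (contact_frame r f * contact_frame s g) = frame_pairing b f g.
Proof.
rewrite big_split_ord /=; congr (_ + _); last first.
  rewrite scaler_sumr; apply: eq_bigr => j _.
  rewrite big_split_ord /= big1 ?add0r => [|i _]; last first.
    by rewrite /contact_omega block_mxEdl mxE mulr0 scale0r.
  rewrite (bigD1 j) //= big1 ?addr0 => [|i ij]; last first.
    by rewrite /contact_omega block_mxEdr mxE eq_sym (negbTE ij) mulr0 scale0r.
  rewrite /contact_omega block_mxEdr mxE eqxx mulr1 !contact_frame_theta.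
  by rewrite /contact_frame_odd /= leq_addr andbT.
have even s : contact_frame_odd (lshift n s) = false :> bool.
  by rewrite /contact_frame_odd leqNgt /= ltn_ord.
under eq_bigr => s _.
  rewrite even andbF big_split_ord /= [X in _ + X]big1 ?addr0; last first.
    by move=> j _; rewrite /contact_omega block_mxEur mxE mulr0 scale0r.
  under eq_bigr => t _ do rewrite mul1r /contact_omega block_mxEul.
  over.
rewrite big_split_ord /= sumrB addrC -sumrN; congr (_ + _); apply: eq_bigr => i _.
  rewrite big_split_ord /= [X in _ + X]big1 ?addr0; last first.
    by move=> k _; rewrite block_mxEdr mxE scale0r.
  rewrite (bigD1 i) //= block_mxEdl mxE eqxx scale1r contact_frame_x contact_frame_y.
  by rewrite big1 ?addr0 // => k ki; rewrite block_mxEdl mxE eq_sym (negbTE ki) scale0r.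
rewrite big_split_ord /= [X in X + _]big1 ?add0r; last first.
  by move=> k _; rewrite block_mxEul mxE scale0r.
rewrite (bigD1 i) //= block_mxEur !mxE eqxx scaleN1r contact_frame_x contact_frame_y.
rewrite big1 ?addr0 // => k ki.
by rewrite block_mxEur !mxE eq_sym (negbTE ki) oppr0 scale0r.
Qed.

Lemma frame_xE i :
  frame_x i = 1 *: (fun g => y i * d_z g) + @even_partial R m n (x_idx i).
Proof. by apply/funext => f; rewrite fun_combE scale1r addrC. Qed.

Lemma frame_yE i :
  frame_y i = -1 *: (fun g => x i * d_z g) + @even_partial R m n (y_idx i).
Proof. by apply/funext => f; rewrite fun_combE scaleN1r addrC. Qed.

Lemma frame_thetaE j :
  frame_theta j = -1 *: (fun g => theta j * d_z g) + @odd_partial R m n j.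
Proof. by apply/funext => f; rewrite fun_combE scaleN1r addrC. Qed.

Lemma superder_frame_x i : superderivation false (frame_x i).
Proof.
rewrite frame_xE; apply: superder_comb; last exact: superder_even_partial.
exact: superder_mul (shom_even_coord R n (y_idx i)) (superder_even_partial R n _).
Qed.

Lemma superder_frame_y i : superderivation false (frame_y i).
Proof.
rewrite frame_yE; apply: superder_comb; last exact: superder_even_partial.
exact: superder_mul (shom_even_coord R n (x_idx i)) (superder_even_partial R n _).
Qed.

Lemma superder_frame_theta j : superderivation true (frame_theta j).
Proof.
rewrite frame_thetaE; apply: superder_comb; last exact: superder_odd_partial.
exact: superder_mul (shom_odd_coord R m j) (superder_even_partial R n _).
Qed.

Lemma chain_rule_frame_x i : chain_rule (frame_x i).
Proof.
rewrite frame_xE; apply: chain_rule_comb; last exact: chain_rule_even_partial.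
by apply: chain_rule_mul; exact: chain_rule_even_partial.
Qed.

Lemma chain_rule_frame_y i : chain_rule (frame_y i).
Proof.
rewrite frame_yE; apply: chain_rule_comb; last exact: chain_rule_even_partial.
by apply: chain_rule_mul; exact: chain_rule_even_partial.
Qed.

Lemma chain_rule_frame_theta j : chain_rule (frame_theta j).
Proof.
rewrite frame_thetaE; apply: chain_rule_comb; last exact: chain_rule_odd_partial.
by apply: chain_rule_mul; exact: chain_rule_even_partial.
Qed.

Lemma frame_pairing_combl b a f1 f2 g : frame_pairing b (a *: f1 + f2) g =
  a *: frame_pairing b f1 g + frame_pairing b f2 g.
Proof.
rewrite /frame_pairing scalerDr addrACA; congr (_ + _).
  rewrite scaler_sumr -big_split /=; apply: eq_bigr => i _.
  rewrite (superder_linear (superder_frame_x i)) (superder_linear (superder_frame_y i)).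
  rewrite [_ * frame_x i g]mulrDl [_ * frame_y i g]mulrDl -!scalerAl scalerBr opprD.
  by rewrite addrACA.
rewrite scalerA mulrC -scalerA -scalerDr; congr (_ *: _).
rewrite scaler_sumr -big_split /=; apply: eq_bigr => j _.
by rewrite (superder_linear (superder_frame_theta j)) mulrDl -scalerAl.
Qed.

Lemma frame_pairing0l b g : frame_pairing b 0 g = 0.
Proof.
have := frame_pairing_combl b (-1) 0 0 g.
by rewrite scaler0 addr0 scaleN1r addNr.
Qed.

Lemma contact_fieldE b f g : shom b f ->
  contact_field f g = f * d_z g - 2^-1 *: frame_pairing b f g.
Proof.
move=> fb; rewrite /contact_field (bigD1 b) //= fb frame_pairingE.
rewrite big1 ?addr0 // => c cb; rewrite (shom_partE c fb) (negbTE cb) mul0r.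
by rewrite frame_pairingE frame_pairing0l scaler0 subr0.
Qed.

Lemma contact_field_comb a f1 f2 :
  contact_field (a *: f1 + f2) = a *: contact_field f1 + contact_field f2 :> (SF -> SF).
Proof.
apply/funext => g; rewrite fun_combE /contact_field scaler_sumr -big_split /=.
apply: eq_bigr => b _; rewrite !frame_pairingE linearP frame_pairing_combl.
have comb (k : R) (A1 A2 P1 P2 : SF) : a *: A1 + A2 - k *: (a *: P1 + P2) =
    a *: (A1 - k *: P1) + (A2 - k *: P2).
  by rewrite scalerBr scalerDr !scalerA [a * k]mulrC opprD addrACA.
by rewrite mulrDl -scalerAl; exact: comb.
Qed.

(** X_f becomes a combination of operators g -> h * T g, with T equal to d_z or a frame field, which
    inherit the Leibniz rule and the chain rule from T. *)
Lemma contact_field_hom b f : shom b f -> contact_field f =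
  (fun g => f * d_z g) - 2^-1 *: (
    \sum_(i < l) ((fun g => frame_y i f * frame_x i g) -
                  (fun g => frame_x i f * frame_y i g)) +
    (-1) ^+ b *: \sum_(j < n) (fun g => frame_theta j f * frame_theta j g)).
Proof.
move=> fb; apply/funext => g; rewrite (contact_fieldE g fb) /frame_pairing.
congr (_ - _ *: _); rewrite [RHS]/(_ + _) /=; congr (_ + _); first by rewrite fct_sumE.
by rewrite -[RHS]/(_ *: _) fct_sumE.
Qed.

Lemma superder_contact_field b f : shom b f -> superderivation b (contact_field f).
Proof.
move=> fb; rewrite (contact_field_hom fb) addrC -scaleNr.
apply: superder_comb; last first.
  by rewrite -[b]addbF; exact: superder_mul fb (@superder_even_partial R m n _).
rewrite addrC; apply: superder_comb; apply: superder_sum => k _.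
  (* The coefficient has parity b + 1 and the odd frame field parity 1, so the product has parity
     b. *)
  have := superder_mul (superder_shom (superder_frame_theta k) fb) (superder_frame_theta k).
  by rewrite -addbA addbC -addbA addbb addbF.
rewrite addrC -scaleN1r.
have Dx := superder_mul (superder_shom (superder_frame_x k) fb) (superder_frame_y k).
have Dy := superder_mul (superder_shom (superder_frame_y k) fb) (superder_frame_x k).
rewrite addbF in Dx; rewrite addbF in Dy; have := superder_comb (-1) Dx Dy; exact.
Qed.

Lemma chain_rule_contact_field b f : shom b f -> chain_rule (contact_field f).
Proof.
move=> fb; rewrite (contact_field_hom fb) addrC -scaleNr.
apply: chain_rule_comb; last by apply: chain_rule_mul; exact: chain_rule_even_partial.
rewrite addrC; apply: chain_rule_comb; apply: chain_rule_sum => k _.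
  by apply: chain_rule_mul; exact: chain_rule_frame_theta.
rewrite addrC -scaleN1r; apply: chain_rule_comb; apply: chain_rule_mul.
  exact: chain_rule_frame_y.
exact: chain_rule_frame_x.
Qed.

End ContactFields.

(** * Values of the frame and of the bracket on the chart *)

Section ContactChart.
Variables (R : realType) (l n : nat).
Local Notation N := (l.+1 + l.+1 + n)%N.
Local Notation m := (1 + (l + l))%N.
Local Notation SF := (superfun R m n).
Local Notation G := (spo_gram R l n).
Local Notation odd i := (@idx_odd (l.+1 + l.+1) n i).
Local Notation z := (even_coord R n (z_idx l)).
Local Notation x i := (even_coord R n (x_idx i)).
Local Notation y i := (even_coord R n (y_idx i)).
Local Notation theta j := (odd_coord R m j).
Local Notation d_z := (@even_partial R m n (z_idx l)).
Local Notation w := (@chart R l n).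
Local Notation frame_x := (@frame_x R l n).
Local Notation frame_y := (@frame_y R l n).
Local Notation frame_theta := (@frame_theta R l n).
Implicit Types (b c : bool) (A B Q : 'M[R]_N) (f g h : SF) (X Y T : SF -> SF).

Lemma eq_coord_idx : (forall i k : 'I_l, (x_idx i == x_idx k) = (i == k)) *
  (forall i k : 'I_l, (y_idx i == y_idx k) = (i == k)) *
  (forall i k : 'I_l, (x_idx i == y_idx k) = false) *
  (forall i k : 'I_l, (y_idx i == x_idx k) = false) *
  (forall i : 'I_l, (x_idx i == z_idx l) = false) *
  (forall i : 'I_l, (y_idx i == z_idx l) = false) *
  (forall i : 'I_l, (z_idx l == x_idx i) = false) *
  (forall i : 'I_l, (z_idx l == y_idx i) = false).
Proof.
rewrite /x_idx /y_idx /z_idx.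
by do !split=> *; rewrite ?eq_rshift ?eq_lshift ?eq_lrshift ?eq_rlshift
  ?eq_lshift ?eq_rshift ?eq_lrshift ?eq_rlshift.
Qed.

Lemma d_zE : (d_z 1 = 0) * (forall i, d_z (x i) = 0) * (d_z z = 1) *
  (forall i, d_z (y i) = 0) * (forall j, d_z (theta j) = 0).
Proof.
by do !split=> *; rewrite ?(superder1 (superder_even_partial _ _ _))
  ?even_partial_even_coord ?even_partial_odd_coord ?eq_coord_idx ?eqxx.
Qed.

Lemma frame_x_chart : (forall i, frame_x i 1 = 0 :> SF) *
  (forall i k, frame_x i (x k) = (i == k)%:R :> SF) * (forall i, frame_x i z = y i) *
  (forall i k, frame_x i (y k) = 0) * (forall i j, frame_x i (theta j) = 0).
Proof.
do !split=> *; first exact: superder1 (superder_frame_x R n _).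
all: by rewrite /frame_x ?even_partial_even_coord ?even_partial_odd_coord
  ?eq_coord_idx ?eqxx ?mulr0 ?mulr1 ?addr0 ?add0r.
Qed.

Lemma frame_y_chart : (forall i, frame_y i 1 = 0 :> SF) *
  (forall i k, frame_y i (x k) = 0 :> SF) * (forall i, frame_y i z = - x i) *
  (forall i k, frame_y i (y k) = (i == k)%:R) * (forall i j, frame_y i (theta j) = 0).
Proof.
do !split=> *; first exact: superder1 (superder_frame_y R n _).
all: by rewrite /frame_y ?even_partial_even_coord ?even_partial_odd_coord
  ?eq_coord_idx ?eqxx ?mulr0 ?mulr1 ?subr0 ?sub0r.
Qed.

Lemma frame_theta_chart : (forall j, frame_theta j 1 = 0 :> SF) *
  (forall j k, frame_theta j (x k) = 0 :> SF) *
  (forall j, frame_theta j z = - theta j) *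
  (forall j k, frame_theta j (y k) = 0 :> SF) *
  (forall j k, frame_theta j (theta k) = (j == k)%:R).
Proof.
do !split=> *; first exact: superder1 (superder_frame_theta R l _).
all: by rewrite /frame_theta ?even_partial_even_coord ?even_partial_odd_coord
  ?odd_partial_even_coord ?odd_partial_odd_coord
  ?eq_coord_idx ?eqxx ?mulr0 ?mulr1 ?subr0 ?sub0r.
Qed.

Lemma sum_delta_r (I : finType) (F : I -> SF) k : \sum_i F i * (i == k)%:R = F k.
Proof.
rewrite (bigD1 k) //= eqxx mulr1 big1 ?addr0 // => i /negbTE ->.
by rewrite mulr0.
Qed.

Lemma sum_delta_l (I : finType) (F : I -> SF) k : \sum_i (i == k)%:R * F i = F k.
Proof.
rewrite (bigD1 k) //= eqxx mul1r big1 ?addr0 // => i /negbTE ->.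
by rewrite mul0r.
Qed.

Lemma sum_delta_scale (I : finType) (F : I -> SF) k :
  \sum_i (i == k)%:R *: F i = F k.
Proof.
rewrite (bigD1 k) //= eqxx scale1r big1 ?addr0 // => i /negbTE ->.
by rewrite scale0r.
Qed.

Lemma frame_pairing_one b f : frame_pairing b f 1 = 0.
Proof.
rewrite /frame_pairing !big1 ?scaler0 ?addr0 // => i _; first by rewrite frame_theta_chart mulr0.
by rewrite frame_x_chart frame_y_chart !mulr0 subr0.
Qed.

Lemma frame_pairing_x b f k : frame_pairing b f (x k) = frame_y k f.
Proof.
rewrite /frame_pairing [X in _ *: X]big1 => [|j _]; last by rewrite frame_theta_chart mulr0.
rewrite scaler0 addr0 -[RHS](sum_delta_r (fun i => frame_y i f)).
by apply: eq_bigr => i _; rewrite frame_x_chart frame_y_chart mulr0 subr0.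
Qed.

Lemma frame_pairing_y b f k : frame_pairing b f (y k) = - frame_x k f.
Proof.
rewrite /frame_pairing [X in _ *: X]big1 => [|j _]; last by rewrite frame_theta_chart mulr0.
rewrite scaler0 addr0 -(sum_delta_r (fun i => frame_x i f)) -sumrN.
by apply: eq_bigr => i _; rewrite frame_x_chart frame_y_chart mulr0 sub0r.
Qed.

Lemma frame_pairing_theta b f k :
  frame_pairing b f (theta k) = (-1) ^+ b *: frame_theta k f.
Proof.
rewrite /frame_pairing big1 => [|i _].
  rewrite add0r -[in RHS](sum_delta_r (fun j => frame_theta j f)).
  by congr (_ *: _); apply: eq_bigr => j _; rewrite frame_theta_chart.
by rewrite frame_x_chart frame_y_chart !mulr0 subr0.
Qed.

Lemma frame_pairing_z b f : frame_pairing b f z =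
  \sum_i (frame_y i f * y i + frame_x i f * x i) -
  (-1) ^+ b *: \sum_j frame_theta j f * theta j.
Proof.
rewrite /frame_pairing -scalerN -sumrN; congr (_ + _ *: _); apply: eq_bigr => i _.
  by rewrite frame_x_chart frame_y_chart mulrN opprK.
by rewrite frame_theta_chart mulrN.
Qed.

(** Up to normalization, the Poisson bracket of f and g when both are regarded as homogeneous of
    degree one; b is the parity of f. *)
Definition chart_form b f g : SF :=
  2^-1 *: (f * d_z g - d_z f * g - frame_pairing b f g).

Lemma odd_coord_sqr (j : 'I_n) : theta j * theta j = 0.
Proof.
have o := shom_odd_coord R m j; have /eqP := shom_mulC o o.
rewrite scaleN1r -addr_eq0 -mulr2n -scaler_nat scaler_eq0 pnatr_eq0 /=.
by move/eqP.
Qed.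

Lemma even_coordC i f : even_coord R n i * f = f * even_coord R n i.
Proof.
have e := shom_even_coord R n i.
rewrite (superfun_part_sum f) mulrDl mulrDr.
by rewrite !(shom_mulC e (shom_part _ _)) !scale1r.
Qed.

Lemma eq_index :
  (one_index l n == z_index l n = false) *
  (forall i : 'I_l, (one_index l n == x_index n i) = false) *
  (forall i : 'I_l, (one_index l n == y_index n i) = false) *
  (forall i : 'I_l, (x_index n i == one_index l n) = false) *
  (forall i k : 'I_l, (x_index n i == x_index n k) = (i == k)) *
  (forall i : 'I_l, (x_index n i == z_index l n) = false) *
  (forall i k : 'I_l, (x_index n i == y_index n k) = false) *
  (z_index l n == one_index l n = false) *
  (forall i : 'I_l, (z_index l n == x_index n i) = false) *
  (forall i : 'I_l, (z_index l n == y_index n i) = false) *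
  (forall i : 'I_l, (y_index n i == one_index l n) = false) *
  (forall i k : 'I_l, (y_index n i == x_index n k) = false) *
  (forall i : 'I_l, (y_index n i == z_index l n) = false) *
  (forall i k : 'I_l, (y_index n i == y_index n k) = (i == k)) *
  (forall j : 'I_n, (theta_index l j == one_index l n) = false) *
  (forall (j : 'I_n) (i : 'I_l), (theta_index l j == x_index n i) = false) *
  (forall j : 'I_n, (theta_index l j == z_index l n) = false) *
  (forall (j : 'I_n) (i : 'I_l), (theta_index l j == y_index n i) = false) *
  (forall j : 'I_n, (one_index l n == theta_index l j) = false) *
  (forall (j : 'I_n) (i : 'I_l), (x_index n i == theta_index l j) = false) *
  (forall j : 'I_n, (z_index l n == theta_index l j) = false) *
  (forall (j : 'I_n) (i : 'I_l), (y_index n i == theta_index l j) = false) *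
  (forall j k : 'I_n, (theta_index l j == theta_index l k) = (j == k)).
Proof.
rewrite /one_index /x_index /y_index /z_index /theta_index.
by do !split=> *; rewrite ?eq_rshift ?eq_lshift ?eq_lrshift ?eq_rlshift
  ?eq_lshift ?eq_rshift ?eq_lrshift ?eq_rlshift ?(inj_eq lift_inj).
Qed.

Lemma scale_natr1 (b : bool) : b%:R *: (1 : SF) = b%:R.
Proof. by case: b; rewrite ?scale1r ?scale0r. Qed.

(** The functions [w a] behave as Darboux coordinates: their brackets are constants. This is what
    makes a quadratic function act linearly on them. *)
Lemma chart_formE (a b : 'I_N) :
  chart_form (odd b) (w b) (w a) = (2^-1 * G a b) *: 1.
Proof.
rewrite -scalerA /chart_form; congr (_ *: _).
elim/index_ind: a => [|k||k|k]; rewrite gramE chartE d_zE ?mulr0 ?sub0r.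
- rewrite mulr1 frame_pairing_one subr0 scaleNr scale_natr1; congr (- _).
  by elim/index_ind: b => [|i||i|i]; rewrite chartE d_zE ?eq_index ?eqxx.
- rewrite frame_pairing_x scaleNr scale_natr1.
  elim/index_ind: b => [|i||i|i]; rewrite chartE d_zE frame_y_chart ?eq_index ?eqxx ?mul0r ?mul1r ?oppr0 ?add0r ?opprK ?subrr //.
    by rewrite addNr.
  by rewrite eq_sym.
(* The row of z is the only one where products of coordinates survive. If [w b] is x_i, y_i or
   theta_j, the pairing returns [w b] and cancels [w b * d_z z]; if [w b] is z, its terms vanish by
   commutativity and theta_j^2 = 0. *)
- rewrite mulr1 scale_natr1 frame_pairing_z.
  elim/index_ind: b => [|i||i|i]; rewrite chartE d_zE ?eq_index ?eqxx ?mul0r ?mul1r ?subr0 ?subrr ?sub0r.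
  + rewrite !big1 ?scaler0 ?subr0 // => j _; first by rewrite frame_theta_chart mul0r.
    by rewrite frame_x_chart frame_y_chart !mul0r addr0.
  + rewrite [X in _ *: X]big1 ?scaler0 ?subr0 => [|j _]; last first.
      by rewrite frame_theta_chart mul0r.
    apply/eqP; rewrite subr_eq0 -[X in X == _](sum_delta_l (fun k => x k)); apply/eqP.
    by apply: eq_bigr => k _; rewrite frame_x_chart frame_y_chart mul0r add0r.
  + rewrite !big1 ?scaler0 ?subr0 ?oppr0 // => j _.
      by rewrite frame_theta_chart mulNr odd_coord_sqr oppr0.
    by rewrite frame_x_chart frame_y_chart mulNr even_coordC addNr.
  + rewrite [X in _ *: X]big1 ?scaler0 ?subr0 => [|j _]; last first.
      by rewrite frame_theta_chart mul0r.
    apply/eqP; rewrite subr_eq0 -[X in X == _](sum_delta_l (fun k => y k)); apply/eqP.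
    by apply: eq_bigr => k _; rewrite frame_x_chart frame_y_chart mul0r addr0.
  rewrite big1 => [|k _]; last by rewrite frame_x_chart frame_y_chart !mul0r addr0.
  rewrite idx_oddE scaleN1r opprK add0r; apply/eqP; rewrite subr_eq0; apply/eqP.
  rewrite -[LHS](sum_delta_l (fun k => theta k)); apply: eq_bigr => k _.
  by rewrite frame_theta_chart.
- rewrite frame_pairing_y opprK scale_natr1.
  elim/index_ind: b => [|i||i|i]; rewrite chartE d_zE frame_x_chart ?eq_index ?eqxx ?mul0r ?mul1r ?oppr0 ?add0r ?addNr //.
  by rewrite eq_sym.
rewrite frame_pairing_theta scale_natr1.
elim/index_ind: b => [|i||i|i]; rewrite chartE d_zE frame_theta_chart idx_oddE ?eq_index ?eqxx ?mul0r ?mul1r ?oppr0 ?add0r ?scaler0 ?oppr0 //.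
  by rewrite scale1r opprK addNr.
by rewrite scaleN1r opprK eq_sym.
Qed.

End ContactChart.

(** * Quadratic functions acting on the chart, and their brackets *)

Section ContactIsomorphism.
Variables (R : realType) (l n : nat).
Local Notation N := (l.+1 + l.+1 + n)%N.
Local Notation m := (1 + (l + l))%N.
Local Notation SF := (superfun R m n).
Local Notation G := (spo_gram R l n).
Local Notation odd i := (@idx_odd (l.+1 + l.+1) n i).
Local Notation d_z := (@even_partial R m n (z_idx l)).
Local Notation w := (@chart R l n).
Local Notation frame_x := (@frame_x R l n).
Local Notation frame_y := (@frame_y R l n).
Local Notation frame_theta := (@frame_theta R l n).
Implicit Types (b c : bool) (A B Q : 'M[R]_N) (f g h : SF) (X Y T : SF -> SF).

(** The frame fields are superderivations, hence a Leibniz rule in the first argument, with the sign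
    of moving f2 past g. The extra signs of the odd frame fields are absorbed by the factor (-1)^b
    in the pairing. *)
Lemma frame_pairingM c1 c2 a f1 f2 g : shom c1 f1 -> shom c2 f2 -> shom a g ->
  frame_pairing (c1 (+) c2) (f1 * f2) g =
  f1 * frame_pairing c2 f2 g + (-1) ^+ (c2 && a) *: (frame_pairing c1 f1 g * f2).
Proof.
move=> h1 h2 hg.
have evenM T S : superderivation false T -> superderivation false S ->
    T (f1 * f2) * S g = f1 * (T f2 * S g) + (-1) ^+ (c2 && a) *: (T f1 * S g * f2).
  move=> dT dS; rewrite (superderM dT _ h1) scale1r mulrDl -!mulrA addrC.
  by rewrite (shom_mulC h2 (superder_shom dS hg)) -scalerAr.
have oddM T : superderivation true T ->
    (-1) ^+ (c1 (+) c2) *: (T (f1 * f2) * T g) =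
    (-1) ^+ c2 *: (f1 * (T f2 * T g)) +
    (-1) ^+ (c2 && a) *: ((-1) ^+ c1 *: (T f1 * T g * f2)).
  move=> dT; rewrite (superderM dT _ h1) mulrDl -!mulrA addrC.
  rewrite (shom_mulC h2 (superder_shom dT hg)) -scalerAr -scalerAl mulrA.
  rewrite scalerDr !scalerA; congr (_ *: _ + _ *: _).
  - by case: (c1) (c2) => [] [] /=; rewrite ?mulrNN ?mulr1 ?mul1r.
  - by case: (c1) (c2) (a) => [] [] [] /=; rewrite ?mulrNN ?mulr1 ?mul1r.
have sub_comb (k : R) (u v u' v' : SF) :
    f1 * u + k *: (u' * f2) - (f1 * v + k *: (v' * f2)) =
    f1 * (u - v) + k *: ((u' - v') * f2).
  by rewrite mulrBr mulrBl scalerBr opprD addrACA.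
rewrite /frame_pairing mulrDr mulr_sumr mulrDl mulr_suml scalerDr addrACA.
congr (_ + _).
  rewrite scaler_sumr -big_split /=; apply: eq_bigr => i _.
  rewrite (evenM _ _ (superder_frame_y R n i) (superder_frame_x R n i)).
  rewrite (evenM _ _ (superder_frame_x R n i) (superder_frame_y R n i)).
  exact: sub_comb.
rewrite -!scalerAr -!scalerAl mulr_sumr mulr_suml !scaler_sumr -big_split /=.
apply: eq_bigr => j _.
exact: oddM (superder_frame_theta R l j).
Qed.

(* The action of f on densities of weight -1/2; it is the one that preserves
   the span of the functions w a. *)
Definition density_action f g : SF := contact_field f g - 2^-1 *: (d_z f * g).

(** The Leibniz rule of a Poisson bracket: a product of degree two acts on g of degree one through
    the brackets of its two factors with g. *)
Lemma density_actionM c1 c2 a f1 f2 g : shom c1 f1 -> shom c2 f2 -> shom a g ->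
  density_action (f1 * f2) g =
  f1 * chart_form c2 f2 g + (-1) ^+ (c2 && a) *: (chart_form c1 f1 g * f2).
Proof.
move=> h1 h2 hg; have h12 := shomM h1 h2.
rewrite /density_action (contact_fieldE g h12) (frame_pairingM h1 h2 hg).
rewrite even_partialM /chart_form.
have dg := superder_shom (superder_even_partial R n (z_idx l)) hg.
have E1 : f1 * (f2 * d_z g) = (-1) ^+ (c2 && a) *: (f1 * d_z g * f2).
  by rewrite (shom_mulC h2 dg) -scalerAr mulrA.
have E2 : d_z f1 * (f2 * g) = (-1) ^+ (c2 && a) *: (d_z f1 * g * f2).
  by rewrite (shom_mulC h2 hg) -scalerAr mulrA.
rewrite -scalerAr -scalerAl scalerA mulrC -scalerA.
rewrite (mulrBr f1) (mulrBr f1) (mulrBl f2) (mulrBl f2) !scalerBr -E1 -E2.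
rewrite (mulrDl _ _ g) !scalerDr -!mulrA.
move: (frame_pairing c2 f2 g) (frame_pairing c1 f1 g) => P2 P1.
(* The term f1 * (f2 * d_z g) has coefficient 1 on the left and is shared equally by the two
   brackets on the right. *)
have half (v : SF) : v = 2^-1 *: v + 2^-1 *: v.
  by rewrite -scalerDl -[2^-1]mul1r -mulrDl divff ?scale1r // pnatr_eq0.
rewrite {1}[f1 * (f2 * d_z g)]half.
have regroup (k p q u v : SF) : k + k - (p + q) - (u + v) = k - v - p + (k - u - q).
  by rewrite [RHS]addrACA [k - v + _]addrACA -!opprD addrAC [v + u]addrC.
exact: regroup.
Qed.

Lemma density_action_comb a f1 f2 g : density_action (a *: f1 + f2) g =
  a *: density_action f1 g + density_action f2 g.
Proof.
rewrite /density_action contact_field_comb fun_combE linearP.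
rewrite mulrDl -scalerAl [2^-1 *: (_ + _)]scalerDr scalerA [2^-1 * a]mulrC -scalerA.
by rewrite scalerBr opprD addrACA.
Qed.

Lemma density_action0 g : density_action 0 g = 0.
Proof.
have := density_action_comb (-1) 0 0 g.
by rewrite scaler0 addr0 scaleN1r addNr.
Qed.

Lemma density_action_sum (I : Type) (r : seq I) (P : pred I) (F : I -> SF) g :
  density_action (\sum_(i <- r | P i) F i) g =
  \sum_(i <- r | P i) density_action (F i) g.
Proof.
apply: (big_morph (density_action^~ g)) => [f1 f2|]; last exact: density_action0.
by rewrite -[f1]scale1r density_action_comb !scale1r.
Qed.

Lemma density_actionZ a f g : density_action (a *: f) g = a *: density_action f g.
Proof. by rewrite -[_ *: f]addr0 density_action_comb density_action0 addr0. Qed.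

Definition chart_quadratic Q : SF := \sum_c \sum_b Q c b *: (w c * w b).

Definition chart_linear A (a : 'I_N) : SF := \sum_c A c a *: w c.

Fact chart_quadratic_is_linear : linear chart_quadratic.
Proof.
move=> k P Q; rewrite /chart_quadratic scaler_sumr -big_split /=; apply: eq_bigr => c _.
rewrite scaler_sumr -big_split /=; apply: eq_bigr => d _.
by rewrite !mxE scalerDl scalerA.
Qed.

HB.instance Definition _ := GRing.isLinear.Build R 'M[R]_N SF *:%R
  chart_quadratic chart_quadratic_is_linear.

Lemma chart_linear_comb k A B a :
  chart_linear (k *: A + B) a = k *: chart_linear A a + chart_linear B a.
Proof.
rewrite /chart_linear scaler_sumr -big_split /=; apply: eq_bigr => c _.
by rewrite !mxE scalerDl scalerA.
Qed.

(** By the Leibniz rule and the constant brackets, each product [w c * w d] gives two terms with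
    coefficient 1/2. After exchanging c and d in one of them, supersymmetry of Q makes the two
    contributions equal. *)
Lemma density_action_chart Q a : supersymmetric Q ->
  density_action (chart_quadratic Q) (w a) = chart_linear (Q *m G^T) a.
Proof.
move=> SQ; rewrite /chart_quadratic density_action_sum.
under eq_bigr => c _.
  rewrite density_action_sum.
  under eq_bigr => d _.
    rewrite density_actionZ.
    rewrite (density_actionM (shom_chart R c) (shom_chart R d) (shom_chart R a)).
    rewrite !chart_formE -scalerAr -scalerAl mulr1 mul1r scalerA scalerDr !scalerA.
    over.
  rewrite big_split /=; over.
rewrite big_split /= [X in _ + X]exchange_big -big_split /=.
apply: eq_bigr => c _; rewrite -scaler_suml -scaler_suml -scalerDl; congr (_ *: _).
rewrite [RHS]mxE -big_split /=; apply: eq_bigr => d _; rewrite [G^T d a]mxE.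
have [ad|ad] := eqVneq (odd a) (odd d); last by rewrite spo_gram_even // !mulr0 addr0.
rewrite ad (SQ d c) andbC.
rewrite mulrACA -expr2 sqrr_sign mul1r -mulrDr -mulrDl.
by rewrite (_ : 2^-1 + 2^-1 = 1 :> R) ?mul1r //; lra.
Qed.

Definition chart_field A : SF -> SF := contact_field (chart_quadratic (A *m G)).

Lemma chart_field_comb k A B :
  chart_field (k *: A + B) = k *: chart_field A + chart_field B.
Proof. by rewrite /chart_field mulmxDl -scalemxAl linearP contact_field_comb. Qed.

Lemma shom_chart_linear b A a : gl_part b A = A -> shom (b (+) odd a) (chart_linear A a).
Proof.
move=> Ab; apply: shom_sum => c _.
have [ca|/(gl_part_eq0 Ab)->] := eqVneq (odd c (+) odd a) b; last first.
  by rewrite scale0r; exact: shom0.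
have -> : b (+) odd a = odd c by rewrite -ca; case: (odd c) (odd a) => [] [].
by apply: shomZ; exact: shom_chart.
Qed.

Lemma shom_chart_quadratic b Q : gl_part b Q = Q -> shom b (chart_quadratic Q).
Proof.
move=> Qb; apply: shom_sum => c _; apply: shom_sum => d _.
have [<-|/(gl_part_eq0 Qb)->] := eqVneq (odd c (+) odd d) b; last first.
  by rewrite scale0r; exact: shom0.
by apply: shomZ; apply: shomM; exact: shom_chart.
Qed.

Lemma gl_part_gram b A : gl_part b A = A -> gl_part b (A *m G) = A *m G.
Proof. by move=> Ab; rewrite gl_part_mul_even ?spo_gram_part // Ab. Qed.

Lemma superder_chart_field b A : gl_part b A = A -> superderivation b (chart_field A).
Proof.
move=> Ab; apply: superder_contact_field; apply: shom_chart_quadratic.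
exact: gl_part_gram.
Qed.

Lemma chain_rule_chart_field b A : gl_part b A = A -> chain_rule (chart_field A).
Proof.
move=> Ab; apply: (@chain_rule_contact_field R l n b); apply: shom_chart_quadratic.
exact: gl_part_gram.
Qed.

Lemma gl_part_idem b A : gl_part b (gl_part b A) = gl_part b A.
Proof. by rewrite gl_part_part eqxx. Qed.

Lemma chart_field_sum A :
  chart_field A = 1 *: chart_field (gl_part false A) + chart_field (gl_part true A).
Proof. by rewrite -chart_field_comb scale1r -gl_part_sum. Qed.

Lemma op_part_superder_sum b X Y : superderivation false X -> superderivation true Y ->
  op_part b (1 *: X + Y) = if b then Y else X.
Proof.
move=> dX dY; rewrite op_part_comb (superder_op_part b dX) (superder_op_part b dY).
by case: b; rewrite ?scaler0 ?scale1r ?add0r ?addr0.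
Qed.

Lemma op_part_chart_field b A : op_part b (chart_field A) = chart_field (gl_part b A).
Proof.
have d c := superder_chart_field (gl_part_idem c A).
rewrite chart_field_sum (op_part_superder_sum b (d false) (d true)).
by case: b.
Qed.

Lemma chart_field_linear A : linear (chart_field A).
Proof.
have d c := superder_chart_field (gl_part_idem c A).
rewrite chart_field_sum; apply: linear_comb.
  exact: superder_linear (d false).
exact: superder_linear (d true).
Qed.

Lemma chart_field1 A : chart_field A 1 = 0.
Proof.
have d c := superder1 (superder_chart_field (gl_part_idem c A)).
by rewrite chart_field_sum fun_combE (d false) (d true) scaler0 addr0.
Qed.

Local Notation one := (one_index l n).

Lemma chart_field_chart A a : spo A ->
  chart_field A (w a) = chart_linear A a - chart_linear A one * w a.
Proof.
move=> /spoP SA; have E (c : 'I_N) := density_action_chart c SA.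
have AE : A *m G *m G^T = A by rewrite -mulmxA spo_gramV mulmx1.
(* On the constant 1 only the zeroth-order term of the density action survives, so the first
   component of W A is -1/2 d_z f; substituted back, it gives the projective correction. *)
have := E one; rewrite AE /density_action chart_one -/(chart_field A) chart_field1.
rewrite mulr1 sub0r => E1; have := E a; rewrite AE /density_action -/(chart_field A) => <-.
by rewrite -E1 mulNr opprK -scalerAl subrK.
Qed.

Lemma eq_superder_chart b X Y : superderivation b X -> superderivation b Y ->
  chain_rule X -> chain_rule Y -> (forall a, X (w a) = Y (w a)) -> X = Y.
Proof.
move=> dX dY cX cY XY; apply: (eq_superder_coord dX dY cX cY) => [i|j]; last first.
  by have := XY (theta_index l j); rewrite chartE.
case: (split_ordP i) => i' ->.
  by have := XY (z_index l n); rewrite chartE ord1.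
case: (split_ordP i') => k ->.
  by have := XY (x_index n k); rewrite chartE.
by have := XY (y_index n k); rewrite chartE.
Qed.

(** The constant matrix B multiplies the row W from the right and is not touched by the field:
    applying it to W B gives (W A) B up to the projective term. Composition of fields thus matches A
    B in this order, and brackets are preserved rather than reversed. *)
Lemma chart_linear_field A B a : linear (chart_field A) -> spo A ->
  chart_field A (chart_linear B a) =
  chart_linear (A *m B) a - chart_linear A one * chart_linear B a.
Proof.
move=> /linear_pack[X XE] SA; rewrite /chart_linear XE raddf_sum /= mulr_sumr.
under eq_bigr do rewrite linearZ /= -XE chart_field_chart // scalerBr scalerAr.
rewrite sumrB; congr (_ - _).
transitivity (\sum_i \sum_c B i a *: (A c i *: w c)).
  by apply: eq_bigr => i _; exact: scaler_sumr.
rewrite exchange_big; apply: eq_bigr => c _; rewrite mxE scaler_suml.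
by apply: eq_bigr => d _; rewrite scalerA mulrC.
Qed.

(** The letters are the terms of the two compositions on W_a: p and q are (W A B)_a and (W B A)_a; P
    and Q are (W A B)_1 W_a and (W B A)_1 W_a; u and v are (W A)_1 (W B)_a and (W B)_1 (W A)_a; e
    and e' are W_a times both projective factors, in either order. *)
Lemma commutator_cancel (s : R) (p q P Q u v e e' : SF) : s * s = 1 ->
  p - u - (P - e + s *: (v - e')) - s *: (q - v - (Q - e' + s *: (u - e))) =
  (p - s *: q) - (P - s *: Q).
Proof.
move=> ss; have swap (a b c d k : SF) : a - b - (c - d + k) = a - c - (b - d + k).
  by rewrite -!addrA -!opprD; congr (_ - _); rewrite !addrA [b + c]addrC.
rewrite (swap p u P e) (swap q v Q e') [s *: (q - Q - _)]scalerBr [s *: (v - e' + _)]scalerDr scalerA ss scale1r.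
rewrite [s *: (v - e') + _]addrC opprB addrA subrK scalerBr.
by rewrite !opprB [LHS]addrACA [RHS]addrACA [- P - _]addrC.
Qed.

Lemma chart_field_commutator b c A B : gl_part b A = A -> gl_part c B = B ->
  spo A -> spo B -> spo (A *m B - (-1) ^+ (b && c) *: (B *m A)) ->
  op_bracket (chart_field A) (chart_field B) =
  chart_field (A *m B - (-1) ^+ (b && c) *: (B *m A)).
Proof.
move=> Ab Bc SA SB SAB.
have ABbc : gl_part (b (+) c) (A *m B - (-1) ^+ (b && c) *: (B *m A)) =
    A *m B - (-1) ^+ (b && c) *: (B *m A).
  rewrite addrC -scaleNr gl_part_comb (gl_part_mul Ab Bc).
  by rewrite addbC (gl_part_mul Bc Ab).
have dA := superder_chart_field Ab; have dB := superder_chart_field Bc.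
have cA := chain_rule_chart_field Ab; have cB := chain_rule_chart_field Bc.
rewrite (op_bracket_superder dA dB).
apply: (eq_superder_chart (superder_comm dA dB) (superder_chart_field ABbc)
  (chain_rule_comm dA dB cA cB) (chain_rule_chart_field ABbc)) => a.
have lA := superder_linear dA; have lB := superder_linear dB.
have XB a' := @chart_linear_field A B a' lA SA.
have YA a' := @chart_linear_field B A a' lB SB.
have h1 := @shom_chart_linear b A one Ab; have h2 := @shom_chart_linear c B one Bc.
rewrite idx_oddE !addbF in h1 h2.
have CE a' : chart_linear (A *m B - (-1) ^+ (b && c) *: (B *m A)) a' =
    chart_linear (A *m B) a' - (-1) ^+ (b && c) *: chart_linear (B *m A) a'.
  by rewrite addrC -scaleNr chart_linear_comb scaleNr addrC.
have [X XE] := linear_pack lA; have [Y YE] := linear_pack lB.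
have XD u v : chart_field A (u - v) = chart_field A u - chart_field A v.
  by rewrite XE raddfB.
have YD u v : chart_field B (u - v) = chart_field B u - chart_field B v.
  by rewrite YE raddfB.
have XA := chart_field_chart a SA; have YB := chart_field_chart a SB.
rewrite fun_commE (chart_field_chart a SAB) XA YB !CE XD YD.
rewrite (superderM dA _ h2) (superderM dB _ h1) !XB !YA XA YB [c && b]andbC.
have ss : (-1 : R) ^+ (b && c) * (-1) ^+ (b && c) = 1 by rewrite -expr2 sqrr_sign.
move: ((-1) ^+ (b && c)) ss => s ss.
rewrite !mulrBl !mulrBr !mulrA -scalerAl.
exact: commutator_cancel.
Qed.

End ContactIsomorphism.

(** * Brackets of chart fields and invariance of the contact distribution *)

Section ContactAlgebra.
Variables (R : realType) (l n : nat).
Local Notation N := (l.+1 + l.+1 + n)%N.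
Local Notation m := (1 + (l + l))%N.
Local Notation SF := (superfun R m n).
Local Notation G := (spo_gram R l n).
Local Notation odd i := (@idx_odd (l.+1 + l.+1) n i).
Local Notation z := (even_coord R n (z_idx l)).
Local Notation x i := (even_coord R n (x_idx i)).
Local Notation y i := (even_coord R n (y_idx i)).
Local Notation theta j := (odd_coord R m j).
Local Notation w := (@chart R l n).
Local Notation frame_x := (@frame_x R l n).
Local Notation frame_y := (@frame_y R l n).
Local Notation frame_theta := (@frame_theta R l n).
Implicit Types (A B Q : 'M[R]_N) (f g h : SF) (X Y T : SF -> SF).
Local Notation one := (one_index l n).
Local Notation chart_field := (@chart_field R l n).

Lemma chart_fieldD A B : chart_field (A + B) = chart_field A + chart_field B.
Proof. by rewrite -[A]scale1r chart_field_comb !scale1r. Qed.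

Lemma chart_field0 : chart_field 0 = 0.
Proof.
have := chart_field_comb (-1) (0 : 'M[R]_N) 0.
by rewrite scaler0 addr0 scaleN1r addNr.
Qed.

Lemma chart_field_bracket A B : spo A -> spo B ->
  chart_field (gl_bracket A B) = op_bracket (chart_field A) (chart_field B).
Proof.
move=> SA SB.
have E b c : chart_field (gl_part b A *m gl_part c B -
      (-1) ^+ (b && c) *: (gl_part c B *m gl_part b A)) =
    (op_part b (chart_field A) \o op_part c (chart_field B)) -
    (-1) ^+ (b && c) *: (op_part c (chart_field B) \o op_part b (chart_field A)).
  have SAb := spo_part b SA; have SBc := spo_part c SB.
  have Ab := gl_part_idem b A; have Bc := gl_part_idem c B.
  have dA := superder_chart_field Ab; have dB := superder_chart_field Bc.
  rewrite !op_part_chart_field -(op_bracket_superder dA dB).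
  rewrite (chart_field_commutator Ab Bc SAb SBc) //.
  (* The summand is the bracket of two homogeneous elements, so it lies in [spo], as
     [chart_field_commutator] requires. *)
  have <- : gl_bracket (gl_part b A) (gl_part c B) =
      gl_part b A *m gl_part c B - (-1) ^+ (b && c) *: (gl_part c B *m gl_part b A).
    have := bracket_homogeneous (@gl_supercommutator R (l.+1 + l.+1) n)
      Logic.I Logic.I Ab Bc.
    exact.
  exact: spo_bracket SAb SBc.
rewrite /gl_bracket (big_morph chart_field chart_fieldD chart_field0).
apply: eq_bigr => b _; rewrite (big_morph chart_field chart_fieldD chart_field0).
by apply: eq_bigr => c _; exact: E.
Qed.

Lemma vector_field_bracket X Y : vector_field X -> vector_field Y ->
  vector_field (op_bracket X Y).
Proof.
move=> /vector_fieldP[lX dX] /vector_fieldP[lY dY].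
have vsum (F : bool -> SF -> SF) :
    (forall b, vector_field (F b)) -> vector_field (\sum_b F b).
  move=> vF; rewrite big_bool /= -[F true]scale1r; exact: vector_field_comb.
apply: (vsum) => b; apply: (vsum) => c.
exact: superder_vector_field (superder_comm (dX b) (dY c)).
Qed.

Definition gram_pairing (F : 'I_N -> SF) : SF :=
  \sum_a \sum_b G a b *: (F a * w b).

Lemma gram_pairingE F : gram_pairing F =
  F (z_index l n) - F one * z +
  \sum_i (F (y_index n i) * x i - F (x_index n i) * y i) +
  \sum_j F (theta_index l j) * theta j.
Proof.
rewrite /gram_pairing sum_index; congr (_ + _); last first.
  apply: eq_bigr => j _; rewrite -chart_theta.
  rewrite -[RHS](sum_delta_scale (fun b => F (theta_index l j) * w b)).
  by apply: eq_bigr => b _; rewrite gramE.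
have row a c k : (forall b, G a b = k * (b == c)%:R) ->
    \sum_b G a b *: (F a * w b) = k *: (F a * w c).
  move=> Gab; rewrite -(sum_delta_scale (fun b => F a * w b) c) scaler_sumr.
  by apply: eq_bigr => b _; rewrite Gab scalerA.
rewrite (row one (z_index l n) (-1)) => [|b]; last by rewrite gramE mulN1r.
rewrite (row (z_index l n) one 1) => [|b]; last by rewrite gramE mul1r.
rewrite scaleN1r scale1r !chartE mulr1 addrACA [- _ + _]addrC; congr (_ + _).
rewrite -big_split /=; apply: eq_bigr => i _.
rewrite (row (x_index n i) (y_index n i) (-1)) => [|b]; last by rewrite gramE mulN1r.
rewrite (row (y_index n i) (x_index n i) 1) => [|b]; last by rewrite gramE mul1r.
by rewrite scaleN1r scale1r !chartE addrC.
Qed.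

Lemma contact_formE Y : Y 1 = 0 -> contact_form Y = gram_pairing (fun a => Y (w a)).
Proof.
move=> Y1; rewrite gram_pairingE chart_z chart_one Y1 mul0r subr0.
have -> : \sum_i (Y (w (y_index n i)) * x i - Y (w (x_index n i)) * y i) =
    \sum_i (x i * Y (y i) - y i * Y (x i)).
  by apply: eq_bigr => i _; rewrite chart_x chart_y !even_coordC.
have -> // : \sum_j Y (w (theta_index l j)) * theta j = \sum_j Y (theta j) * theta j.
by apply: eq_bigr => j _; rewrite chart_theta.
Qed.

Lemma gram_pairing_chart : gram_pairing w = 0.
Proof.
rewrite gram_pairingE !chartE mul1r subrr add0r !big1 ?addr0 // => k _.
  by rewrite chartE odd_coord_sqr.
by rewrite !chartE even_coordC subrr.
Qed.

Lemma vector_field1 X : vector_field X -> X 1 = 0.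
Proof.
move=> /vector_fieldP[lX dX]; rewrite (op_part_sum lX).
by rewrite -[op_part false X]scale1r fun_combE !(superder1 (dX _)) scaler0 addr0.
Qed.

Lemma gram_pairing_comb k (F H : 'I_N -> SF) :
  gram_pairing (fun a => k *: F a + H a) = k *: gram_pairing F + gram_pairing H.
Proof.
rewrite /gram_pairing scaler_sumr -big_split /=; apply: eq_bigr => a _.
rewrite scaler_sumr -big_split /=; apply: eq_bigr => b _.
by rewrite mulrDl -scalerAl scalerDr !scalerA mulrC.
Qed.

(** The Gram matrix is even: in every nonzero term [w d] has the parity of [w c], so a homogeneous T
    gives terms of its own parity. Hence the parts of a tangent field are tangent. *)
Lemma contact_form_part b T : vector_field T ->
  contact_form (op_part b T) = superfun_part b (contact_form T).
Proof.
move=> vT; have [lT dT] := (vector_fieldP _).1 vT.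
rewrite !contact_formE ?(vector_field1 vT) ?(superder1 (dT b)) //.
rewrite /gram_pairing raddf_sum /=; apply: eq_bigr => c _.
rewrite raddf_sum /=; apply: eq_bigr => d _; rewrite linearZ /=.
have [cd|cd] := eqVneq (odd c) (odd d); last by rewrite spo_gram_even // !scale0r.
congr (_ *: _); rewrite (op_part_shomE b lT (shom_chart R c)).
rewrite [in RHS](superfun_part_sum (T (w c))) mulrDl raddfD /=.
have E e : superfun_part b (superfun_part e (T (w c)) * w d) =
    if b == e (+) odd d then superfun_part e (T (w c)) * w d else 0.
  by rewrite (shom_partE _ (shomM (shom_part e _) (shom_chart R d))).
rewrite !E cd.
by case: (b) (odd d) => [] []; rewrite /= ?addr0 ?add0r.
Qed.

(** Write X for the chart field of A. Up to sign, X (T W_a) W_b is X (T (W_a) W_b) minus T (W_a) X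
    (W_b), and summation against G turns the former into X applied to the contact form of T, which
    is 0. The terms containing the row W A cancel because A preserves the form; the projective
    corrections are multiples of the contact form of T or of the pairing of W with itself, both
    0. *)
Lemma gram_pairing_commutator p q A T : gl_part p A = A -> spo A ->
  superderivation q T -> contact_form T = 0 ->
  contact_form ((chart_field A \o T) - (-1) ^+ (p && q) *: (T \o chart_field A)) = 0.
Proof.
move=> Ap SA dT T0; have dX := superder_chart_field Ap.
have lX := superder_linear dX; have lT := superder_linear dT.
rewrite contact_formE; last exact: superder1 (superder_comm dX dT).
rewrite contact_formE in T0; last exact: superder1 dT.
pose S (K : 'I_N -> 'I_N -> SF) := \sum_a \sum_b G a b *: K a b.
have SD k K H : S (fun a b => k *: K a b + H a b) = k *: S K + S H.
  rewrite /S scaler_sumr -big_split /=; apply: eq_bigr => a _.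
  rewrite scaler_sumr -big_split /=; apply: eq_bigr => b _.
  by rewrite scalerDr !scalerA mulrC.
have SM g K : S (fun a b => g * K a b) = g * S K.
  rewrite /S mulr_sumr; apply: eq_bigr => a _; rewrite mulr_sumr; apply: eq_bigr => b _.
  exact: scalerAr.
have SX K : S (fun a b => chart_field A (K a b)) = chart_field A (S K).
  have [X XE] := linear_pack lX; rewrite XE /S raddf_sum /=; apply: eq_bigr => a _.
  by rewrite raddf_sum /=; apply: eq_bigr => b _; rewrite linearZ.
pose rA := @chart_linear R l n A; pose al := rA one.
pose s : R := (-1) ^+ (p && q).
have ss : s * s = 1 by rewrite /s -expr2 sqrr_sign.
have h_al : shom p al by have := shom_chart_linear one Ap; rewrite idx_oddE addbF.
pose U a b := T (w a) * w b.
pose K1 a b := (-1) ^+ (p && (q (+) odd a)) *: (T (w a) * rA b).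
pose K2 a b := T (rA a) * w b.
have SU : S U = 0 by exact: T0.
have SV : S (fun a b => w a * w b) = 0 by exact: gram_pairing_chart.
have XT a b : chart_field A (T (w a)) * w b =
    chart_field A (U a b) - K1 a b + al * U a b.
  have hTa := superder_shom dT (shom_chart R a).
  rewrite /U (superderM dX _ hTa) (chart_field_chart b SA) -/(rA b) -/al /K1.
  rewrite mulrBr scalerBr [T (w a) * (al * _)]mulrA (shom_mulC hTa h_al) -scalerAl scalerA [_ && p]andbC.
  rewrite -expr2 sqrr_sign scale1r -mulrA.
  by rewrite [_ *: _ - al * _]addrC addrA addrK subrK.
have TX a b : T (chart_field A (w a)) * w b =
    K2 a b - T al * (w a * w b) - s *: (al * U a b).
  have [T' TE] := linear_pack lT.
  rewrite (chart_field_chart a SA) -/(rA a) -/al TE raddfB /= -TE.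
  rewrite (superderM dT _ h_al) mulrBl mulrDl /K2 /U -scalerAl !mulrA [q && p]andbC.
  by rewrite opprD addrA.
(* This is where invariance of the form enters: collecting the coefficients of [U a d] gives G A^T
   in one sum and A G in the other, related by [spo_homogeneousP]. *)
have SK : S K1 + s *: S K2 = 0.
  have SK1 : S K1 = \sum_a \sum_d
      ((-1) ^+ (p && (q (+) odd a)) * (G *m A^T) a d) *: U a d.
    apply: eq_bigr => a _; rewrite /K1 /rA /chart_linear.
    transitivity (\sum_b \sum_d (G a b * (-1) ^+ (p && (q (+) odd a)) * A d b) *: U a d).
      apply: eq_bigr => b _; rewrite mulr_sumr !scaler_sumr; apply: eq_bigr => d _.
      by rewrite -scalerAr !scalerA.
    rewrite exchange_big; apply: eq_bigr => d _; rewrite -scaler_suml; congr (_ *: _).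
    rewrite mxE mulr_sumr; apply: eq_bigr => b _; rewrite [A^T _ _]mxE.
    by rewrite mulrA [G a b * _]mulrC.
  have SK2 : S K2 = \sum_a \sum_d (A *m G) a d *: U a d.
    rewrite /S /K2 /rA /chart_linear exchange_big /= [RHS]exchange_big /=.
    apply: eq_bigr => b _.
    transitivity (\sum_a \sum_d (A d a * G a b) *: U d b).
      apply: eq_bigr => a _; have [T' TE] := linear_pack lT.
      rewrite TE raddf_sum /= mulr_suml scaler_sumr; apply: eq_bigr => d _.
      by rewrite linearZ /= -TE -scalerAl scalerA mulrC.
    rewrite exchange_big; apply: eq_bigr => d _.
    by rewrite mxE scaler_suml.
  rewrite SK1 SK2 scaler_sumr -big_split big1 //= => a _.
  rewrite scaler_sumr -big_split big1 //= => d _.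
  have AGE : (A *m G) a d = - ((-1) ^+ (p && odd a) * (G *m A^T) a d).
    by rewrite ((spo_homogeneousP Ap).1 SA) mxE -mulmxA parity_mxl.
  rewrite scalerA -scalerDl AGE mulrN mulrA /s.
  have -> : (-1 : R) ^+ (p && (q (+) odd a)) = (-1) ^+ (p && q) * (-1) ^+ (p && odd a).
    by case: (p) (q) (odd a) => [] [] []; rewrite /= ?mulrNN ?mulr1 ?mul1r.
  by rewrite subrr scale0r.
have -> : gram_pairing (fun a => ((chart_field A \o T) -
      (-1) ^+ (p && q) *: (T \o chart_field A)) (w a)) =
    S (fun a b => - s *: (K2 a b - T al * (w a * w b) - s *: (al * U a b)) +
       (chart_field A (U a b) - K1 a b + al * U a b)).
  apply: eq_bigr => a _; apply: eq_bigr => b _; congr (_ *: _).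
  by rewrite fun_commE mulrBl -scalerAl XT TX addrC scaleNr.
have SB K H : S (fun a b => K a b - H a b) = S K - S H.
  rewrite [RHS]addrC -scaleN1r -(SD (-1) H K) /S.
  by apply: eq_bigr => a _; apply: eq_bigr => b _; rewrite scaleN1r addrC.
have SP K H : S (fun a b => K a b + H a b) = S K + S H.
  rewrite -[S K]scale1r -(SD 1 K H) /S.
  by apply: eq_bigr => a _; apply: eq_bigr => b _; rewrite scale1r.
have SZ k K : S (fun a b => k *: K a b) = k *: S K.
  rewrite /S scaler_sumr; apply: eq_bigr => a _; rewrite scaler_sumr.
  by apply: eq_bigr => b _; rewrite !scalerA mulrC.
have X0 : chart_field A 0 = 0 by have [X ->] := linear_pack lX; exact: raddf0.
rewrite SD SB SB SM SZ SM SP SB SX SM SU SV X0 !mulr0 scaler0 !subr0 addr0 sub0r.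
by rewrite scaleNr -opprD addrC SK oppr0.
Qed.

Lemma contact_vector_chart_field A : spo A -> contact_vector_field (chart_field A).
Proof.
move=> SA; have vX : vector_field (chart_field A).
  apply/vector_fieldP; split=> [|b]; first exact: chart_field_linear.
  by rewrite op_part_chart_field; exact: superder_chart_field (gl_part_idem b A).
split=> // T [vT T0]; split; first exact: vector_field_bracket.
have vXT := vector_field_bracket vX vT.
rewrite (contact_formE (vector_field1 vXT)).
have [lT dT] := (vector_fieldP _).1 vT.
have sum0 (F : bool -> SF -> SF) : (forall b, gram_pairing (fun a => F b (w a)) = 0) ->
    gram_pairing (fun a => (\sum_b F b) (w a)) = 0.
  move=> F0; rewrite big_bool /=.
  have := gram_pairing_comb 1 (fun a => F true (w a)) (fun a => F false (w a)).
  rewrite !F0 scaler0 addr0 => <-; congr gram_pairing; apply/funext => a.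
  by rewrite scale1r.
apply: (sum0) => b; apply: (sum0) => c; rewrite op_part_chart_field.
have Ab := gl_part_idem b A.
rewrite -contact_formE; last first.
  exact: superder1 (superder_comm (superder_chart_field Ab) (dT c)).
apply: (gram_pairing_commutator Ab (spo_part b SA) (dT c)).
by rewrite (contact_form_part c vT) T0 raddf0.
Qed.

End ContactAlgebra.

(** * Polynomials of degree at most two, injectivity, and the isomorphism *)

Section Isomorphism.
Variables (R : realType) (l n : nat).
Local Notation N := (l.+1 + l.+1 + n)%N.
Local Notation m := (1 + (l + l))%N.
Local Notation SF := (superfun R m n).
Local Notation G := (spo_gram R l n).
Local Notation odd i := (@idx_odd (l.+1 + l.+1) n i).
Local Notation z := (even_coord R n (z_idx l)).
Local Notation x i := (even_coord R n (x_idx i)).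
Local Notation y i := (even_coord R n (y_idx i)).
Local Notation w := (@chart R l n).
Local Notation frame_x := (@frame_x R l n).
Local Notation frame_y := (@frame_y R l n).
Local Notation frame_theta := (@frame_theta R l n).
Implicit Types (A B Q : 'M[R]_N) (f g h : SF) (X Y T : SF -> SF).
Local Notation one := (one_index l n).
Local Notation chart_field := (@chart_field R l n).
Local Notation chart_linear := (@chart_linear R l n).
Local Notation chart_quadratic := (@chart_quadratic R l n).
Local Notation poly2 := (@polynomial_deg_le2 R m n).

Lemma polynomial_comb k f g : poly2 f -> poly2 g -> poly2 (k *: f + g).
Proof.
move=> [c [a [q ->]]] [c' [a' [q' ->]]].
exists (k * c + c'), (fun u => k * a u + a' u), (fun u v => k * q u v + q' u v).
have regroup (x1 x2 x3 y1 y2 y3 : SF) :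
    x1 + x2 + x3 + (y1 + y2 + y3) = x1 + y1 + (x2 + y2) + (x3 + y3).
  by rewrite addrACA [x1 + x2 + _]addrACA.
rewrite !scalerDr scalerA regroup -scalerDl; congr (_ + _ + _).
  rewrite scaler_sumr -big_split /=; apply: eq_bigr => u _.
  by rewrite scalerA scalerDl.
rewrite scaler_sumr -big_split /=; apply: eq_bigr => u _.
rewrite scaler_sumr -big_split /=; apply: eq_bigr => v _.
by rewrite scalerA scalerDl.
Qed.

Lemma polynomial_one : poly2 1.
Proof.
exists 1, (fun=> 0), (fun _ _ => 0); rewrite scale1r !big1 ?addr0 // => u _.
  by rewrite big1 // => v _; rewrite scale0r.
by rewrite scale0r.
Qed.

Lemma polynomial_coord u : poly2 (supercoord R u).
Proof.
exists 0, (fun v => (v == u)%:R), (fun _ _ => 0).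
rewrite scale0r add0r sum_delta_scale big1 ?addr0 // => v _.
by rewrite big1 // => v' _; rewrite scale0r.
Qed.

Lemma polynomial_coordM u v : poly2 (supercoord R u * supercoord R v).
Proof.
exists 0, (fun=> 0), (fun u' v' => (u' == u)%:R * (v' == v)%:R).
rewrite scale0r add0r big1 ?add0r => [|u' _]; last by rewrite scale0r.
rewrite -[LHS](sum_delta_scale (fun u' => supercoord R u' * supercoord R v)).
apply: eq_bigr => u' _.
rewrite -[supercoord R u' * _](sum_delta_scale (fun v' => supercoord R u' * supercoord R v')).
by rewrite scaler_sumr; apply: eq_bigr => v' _; rewrite scalerA.
Qed.

Lemma chart_supercoord a : w a = 1 \/ exists u : 'I_m + 'I_n, w a = supercoord R u.
Proof.
elim/index_ind: a => [|i||i|j]; rewrite chartE; first (by left); right.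
- by exists (inl (x_idx i)).
- by exists (inl (z_idx l)).
- by exists (inl (y_idx i)).
by exists (inr j).
Qed.

Lemma supercoord_chart (u : 'I_m + 'I_n) : exists a, supercoord R u = w a.
Proof.
case: u => [i|j]; last by exists (theta_index l j); rewrite chartE.
case: (split_ordP i) => i' ->.
  by exists (z_index l n); rewrite chartE ord1.
case: (split_ordP i') => k ->.
  by exists (x_index n k); rewrite chartE.
by exists (y_index n k); rewrite chartE.
Qed.

Lemma polynomial_quadratic Q : poly2 (chart_quadratic Q).
Proof.
have p0 : poly2 0.
  by have := polynomial_comb (-1) polynomial_one polynomial_one; rewrite scaleN1r addNr.
have pD f g : poly2 f -> poly2 g -> poly2 (f + g).
  by move=> pf pg; rewrite -[f]scale1r; exact: polynomial_comb.
apply: (big_ind poly2 p0 pD) => c _; apply: (big_ind poly2 p0 pD) => d _.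
rewrite -[_ *: _]addr0; apply: polynomial_comb => //.
have [->|[u ->]] := chart_supercoord c; have [->|[v ->]] := chart_supercoord d.
- by rewrite mulr1; exact: polynomial_one.
- by rewrite mul1r; exact: polynomial_coord.
- by rewrite mulr1; exact: polynomial_coord.
exact: polynomial_coordM.
Qed.

Lemma quadratic_delta c d : chart_quadratic (delta_mx c d) = w c * w d.
Proof.
rewrite -[RHS](sum_delta_scale (fun c' => w c' * w d)); apply: eq_bigr => c' _.
rewrite -[w c' * w d](sum_delta_scale (fun d' => w c' * w d')) scaler_sumr.
by apply: eq_bigr => d' _; rewrite mxE scalerA -mulnb natrM.
Qed.

(** Homogenization: the chart contains the constant 1, so terms of degree zero and one are also
    quadratic in the chart. *)
Lemma quadratic_polynomial f : poly2 f -> exists Q, f = chart_quadratic Q.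
Proof.
pose P f := exists Q, f = chart_quadratic Q.
have PZ k g : P g -> P (k *: g) by move=> [Q ->]; exists (k *: Q); rewrite linearZ.
have PD g h : P g -> P h -> P (g + h).
  by move=> [Q ->] [Q' ->]; exists (Q + Q'); rewrite raddfD.
have P0 : P 0 by exists 0; rewrite raddf0.
have Pw c d : P (w c * w d) by exists (delta_mx c d); rewrite quadratic_delta.
move=> [c [a [q ->]]]; apply: (PD); first apply: (PD).
- by apply: PZ; rewrite -[1]mulr1 -(chart_one R l n); exact: Pw.
- apply: (big_ind P P0 PD) => u _; apply: PZ; have [b ->] := supercoord_chart u.
  by rewrite -[w b]mul1r -(chart_one R l n); exact: Pw.
apply: (big_ind P P0 PD) => u _; apply: (big_ind P P0 PD) => v _; apply: PZ.
by have [b ->] := supercoord_chart u; have [d ->] := supercoord_chart v; exact: Pw.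
Qed.

(** By supercommutativity Q and its signed transpose define the same superfunction, and so does
    their average, which is supersymmetric. *)
Lemma quadratic_supersymmetric Q :
  exists2 S, supersymmetric S & chart_quadratic Q = chart_quadratic S.
Proof.
pose Q' := twist_mx (fun b c => (-1) ^+ (b && c)) Q^T.
exists (2^-1 *: (Q + Q')) => [i j|].
  rewrite !mxE [odd j && odd i]andbC mulrCA; congr (_ * _).
  by rewrite mulrDr mulrA -expr2 sqrr_sign mul1r addrC.
have QE : chart_quadratic Q' = chart_quadratic Q.
  rewrite /chart_quadratic exchange_big; apply: eq_bigr => c _; apply: eq_bigr => d _.
  rewrite !mxE (shom_mulC (shom_chart R d) (shom_chart R c)) scalerA mulrAC.
  by rewrite -expr2 sqrr_sign mul1r.
rewrite scalerDr linearP linearZ /= QE -scalerDl.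
by rewrite (_ : 2^-1 + 2^-1 = 1) ?scale1r //; lra.
Qed.

Lemma quadratic_spo f : poly2 f -> exists2 A, spo A & f = chart_quadratic (A *m G).
Proof.
move=> /quadratic_polynomial[Q ->]; have [S SS ->] := quadratic_supersymmetric Q.
by exists (S *m G^T); rewrite ?spoP -mulmxA spo_gramVl mulmx1.
Qed.

(** The partial derivatives are dual to the chart, except at the index [one], whose function is the
    constant 1 and is killed by every superderivation. *)
Lemma chart_partial (b : 'I_N) : b != one -> exists2 D, superderivation (odd b) D &
  forall a, D (w a) = (a == b)%:R.
Proof.
have even (k : 'I_m) : @even_partial R m n k 1 = 0.
  exact: superder1 (superder_even_partial R n k).
have odd1 j : @odd_partial R m n j 1 = 0 by exact: superder1 (superder_odd_partial R m j).
elim/index_ind: b => [|i||i|j]; rewrite ?eqxx // => _; rewrite idx_oddE.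
- exists (even_partial (x_idx i)); first exact: superder_even_partial.
  elim/index_ind => [|k||k|k]; rewrite chartE ?even ?even_partial_even_coord
    ?even_partial_odd_coord ?eq_coord_idx ?eq_index //.
  by rewrite eq_sym.
- exists (even_partial (z_idx l)); first exact: superder_even_partial.
  by elim/index_ind => [|k||k|k]; rewrite chartE ?even ?even_partial_even_coord
    ?even_partial_odd_coord ?eq_coord_idx ?eq_index ?eqxx.
- exists (even_partial (y_idx i)); first exact: superder_even_partial.
  elim/index_ind => [|k||k|k]; rewrite chartE ?even ?even_partial_even_coord
    ?even_partial_odd_coord ?eq_coord_idx ?eq_index //.
  by rewrite eq_sym.
exists (odd_partial j); first exact: superder_odd_partial.
elim/index_ind => [|k||k|k]; rewrite chartE ?odd1 ?odd_partial_even_coord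
  ?odd_partial_odd_coord ?eq_index //.
by rewrite eq_sym.
Qed.

Lemma chart_linear_partial (b : 'I_N) D C a : superderivation (odd b) D ->
  (forall a, D (w a) = (a == b)%:R) -> D (chart_linear C a) = C b a *: 1.
Proof.
move=> dD Dw; have [D' DE] := linear_pack (superder_linear dD).
rewrite /chart_linear DE raddf_sum /= -(sum_delta_scale (fun c => C c a *: 1) b).
apply: eq_bigr => c _; rewrite linearZ /= -DE Dw scalerA [_ * C c a]mulrC -scalerA.
by case: eqP => _; rewrite ?scale1r ?scale0r.
Qed.

Lemma scale1_inj (k : R) : k *: (1 : SF) = 0 -> k = 0.
Proof. by move=> /eqP; rewrite scaler_eq0 oner_eq0 orbF => /eqP. Qed.

(** Linear independence of the chart: partial derivatives read off all rows of C but that of [one],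
    which is then the only term left. *)
Lemma chart_linear_free C : (forall a, chart_linear C a = 0) -> C = 0.
Proof.
move=> C0; have Cb b a : b != one -> C b a = 0.
  move=> b1; have [D dD Dw] := chart_partial b1; apply: scale1_inj.
  rewrite -(chart_linear_partial C a dD Dw) C0.
  by have [D' ->] := linear_pack (superder_linear dD); exact: raddf0.
apply/matrixP => b a; rewrite mxE; have [->|/Cb//] := eqVneq b one.
apply: scale1_inj; rewrite -(C0 a) /chart_linear (bigD1 one) //= chartE big1 ?addr0 //.
by move=> c /Cb->; rewrite scale0r.
Qed.

(** If the field vanishes then W C = p W with p = (W C)_1, a trivial projective action.
    Differentiating in z shows that p is constant, so C is scalar, and [spo] contains no nonzero
    scalar matrix. *)
Lemma chart_field_inj0 C : spo C -> chart_field C = 0 -> C = 0.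
Proof.
move=> SC C0; pose p := chart_linear C one.
have E a : chart_linear C a = p * w a.
  have := chart_field_chart a SC; rewrite C0 => /esym/eqP.
  by rewrite subr_eq0 => /eqP.
have z1 : z_index l n != one by rewrite eq_index.
have [D dD Dw] := chart_partial z1.
have DC a := chart_linear_partial C a dD Dw; rewrite idx_oddE in dD.
have DL a f g : D (a *: f + g) = a *: D f + D g.
  by rewrite (superder_linear dD).
have D1 : D 1 = 0 by exact: superder1 dD.
have Dz : D z = 1 by have := Dw (z_index l n); rewrite chartE eqxx.
pose kappa := C (z_index l n) (z_index l n); pose k := C (z_index l n) one.
have Dp : D p = k *: 1 by exact: DC.
(* Obtained by applying D to the z-component of W C = p W, that is to p z; k is the z-derivative of
   p. *)
have kp : kappa *: 1 = p + k *: z.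
  rewrite -(DC (z_index l n)) E chart_z -even_coordC.
  rewrite (superderM dD _ (shom_even_coord R n (z_idx l))) scale1r Dz mul1r Dp.
  by rewrite -scalerAr mulr1.
have k0 : k = 0.
  have D0 : D 0 = 0 by have := DL (-1) 0 0; rewrite scaler0 addr0 scaleN1r addNr.
  have : D (kappa *: 1) = 0 by rewrite -[_ *: _]addr0 DL D1 D0 scaler0 addr0.
  (* A second z-derivative gives k + k = 0. *)
  rewrite kp addrC DL Dp Dz -scalerDl => /scale1_inj; lra.
have pE : p = kappa *: 1 by rewrite kp k0 scale0r addr0.
have scalarE a : chart_linear kappa%:M a = kappa *: w a.
  rewrite -[RHS](sum_delta_scale (fun c => kappa *: w c)); apply: eq_bigr => c _.
  by rewrite mxE scalerA mulr_natl.
have CE : C = kappa%:M.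
  apply/eqP; rewrite -subr_eq0; apply/eqP; apply: chart_linear_free => a.
  rewrite addrC -scaleN1r chart_linear_comb E pE scalarE.
  by rewrite -scalerAl mul1r scaleN1r addNr.
(* The two entries of G pairing 1 with z are -1 and 1, so supersymmetry of kappa G reads - kappa =
   kappa. *)
have /spoP/(_ one (z_index l n)) := SC.
rewrite CE mul_scalar_mx ![(kappa *: G) _ _]mxE !gramE !eqxx !idx_oddE /= expr0 mul1r mulrN !mulr1 => k2.
have -> : kappa = 0 by lra.
exact: raddf0.
Qed.

Lemma chart_field_inj A B : spo A -> spo B -> chart_field A = chart_field B -> A = B.
Proof.
move=> SA SB AB; apply/eqP; rewrite -subr_eq0; apply/eqP; apply: chart_field_inj0.
  by rewrite addrC -scaleN1r; exact: spo_comb.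
by rewrite addrC -scaleN1r chart_field_comb AB scaleN1r addNr.
Qed.

Lemma contact_algebra_deg2P X :
  @contact_algebra_deg2 R l n X <-> exists2 A, spo A & X = chart_field A.
Proof.
split=> [[_ [f /quadratic_spo[A SA ->] ->]]|[A SA ->]]; first by exists A.
split; first exact: contact_vector_chart_field.
by exists (chart_quadratic (A *m G)) => //; exact: polynomial_quadratic.
Qed.

Lemma contact_algebra_deg2_lie : is_lie_superalgebra (@contact_algebra_deg2 R l n).
Proof.
apply: (super_bracket_lie (@linear_ops_supercommutator R m n)).
- by move=> X /contact_algebra_deg2P[A _ ->]; exact: chart_field_linear.
- apply/contact_algebra_deg2P; exists 0; first exact: spo0.
  by rewrite chart_field0.
- move=> a X Y /contact_algebra_deg2P[A SA ->] /contact_algebra_deg2P[B SB ->].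
  apply/contact_algebra_deg2P; exists (a *: A + B); first exact: spo_comb.
  by rewrite chart_field_comb.
- move=> b X /contact_algebra_deg2P[A SA ->]; apply/contact_algebra_deg2P.
  exists (gl_part b A); first exact: spo_part.
  by rewrite -op_part_chart_field.
move=> X Y /contact_algebra_deg2P[A SA ->] /contact_algebra_deg2P[B SB ->].
apply/contact_algebra_deg2P; exists (gl_bracket A B); first exact: spo_bracket.
by rewrite chart_field_bracket.
Qed.

End Isomorphism.

(** The construction runs from matrices to fields while the isomorphism is required in the other
    direction; injectivity and the description of g as the image of h let every property of psi pass
    to its inverse. *)
Lemma lie_superalgebra_isomorphic_inv (R : pzRingType) (L M : bracketSpace R)
    (g : set L) (h : set M) (psi : M -> L) :
  is_lie_superalgebra g -> is_lie_superalgebra h ->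
  (forall x, g x <-> exists2 A, h A & x = psi A) ->
  (forall A B, h A -> h B -> psi A = psi B -> A = B) ->
  (forall a A B, psi (a *: A + B) = a *: psi A + psi B) ->
  (forall b A, part b (psi A) = psi (part b A)) ->
  (forall A B, h A -> h B -> psi (bracket A B) = bracket (psi A) (psi B)) ->
  lie_superalgebra_isomorphic g h.
Proof.
move=> lie_g lie_h gP inj psiP psi_part psi_bracket; split=> //.
(* The inverse is obtained by choice, with default value 0 outside the image of h. *)
pose phi (x : L) : M := xget 0 [set A | h A /\ x = psi A]%classic.
have phiK A : h A -> phi (psi A) = A.
  move=> hA; apply: xget_unique; first by split.
  by move=> B [hB AB]; exact/esym/(inj _ _ hA hB AB).
exists phi; split.
- split.
  + by move=> x /gP[A hA ->]; rewrite phiK.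
  + move=> x y /set_mem/gP[A hA ->] /set_mem/gP[B hB ->].
    by rewrite (phiK A hA) (phiK B hB) => ->.
  move=> A hA; exists (psi A); last exact: phiK.
  by apply/gP; exists A.
- move=> a x y /gP[A hA ->] /gP[B hB ->].
  rewrite (phiK A hA) (phiK B hB) -psiP phiK //.
  exact: lsa_linear lie_h _ _ _ hA hB.
- move=> b x /gP[A hA ->]; rewrite (phiK A hA) psi_part phiK //.
  exact: lsa_part lie_h _ _ hA.
move=> x y /gP[A hA ->] /gP[B hB ->].
rewrite (phiK A hA) (phiK B hB) -psi_bracket // phiK //.
exact: lsa_bracket lie_h _ _ hA hB.
Qed.

Theorem theorem7p3 (R : realType) (l n : nat) (n_gt0 : (1 <= n)%N) :
  lie_superalgebra_isomorphic (@contact_algebra_deg2 R l n) (@spo R l n).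
Proof.
apply: (@lie_superalgebra_isomorphic_inv R (operator_space R (1 + (l + l)) n)
  (gl_space R (l.+1 + l.+1) n) _ _ (@chart_field R l n)).
- exact: contact_algebra_deg2_lie.
- exact: spo_lie.
- exact: contact_algebra_deg2P.
- exact: chart_field_inj.
- exact: chart_field_comb.
- exact: op_part_chart_field.
exact: chart_field_bracket.
Qed.
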